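(* Let $d\ge 1$ be an integer and let $\varepsilon>0$. There is a constant $C=C(d,\varepsilon)>0$, depending only on $d$ and $\varepsilon$, with the following property. Let $F\in\mathbb{Z}[x_1,x_2,x_3]$ be an absolutely irreducible form of degree $d$, and let $\mathbf{P}=(P_1,P_2,P_3)$ be real numbers with $1\le P_1\le P_2\le P_3$ and $P_3>1$. Let $$T=\max\{P_1^{e_1}P_2^{e_2}P_3^{e_3}\},$$ the maximum being taken over all integer triples $(e_1,e_2,e_3)$ for which the monomial $x_1^{e_1}x_2^{e_2}x_3^{e_3}$ occurs in $F$ with non-zero coefficient, and suppose $T>1$ (this is automatic when $d\ge2$). Put $$\alpha=\frac{\log P_1}{\log P_3},\qquad \beta=\frac{\log P_2}{\log P_3},\qquad \tau=\frac{\log T}{d\log P_3}.$$ If $T\ge (P_1P_2)^d$, then $$N(F;\mathbf{P})\le C\,P_3^{\varepsilon}\exp\left(\frac{\alpha\beta+(\alpha+\beta-\alpha\beta)(\tau-\alpha-\beta)}{d(\tau-\alpha)(\tau-\beta)}\log P_3\right),$$ where, in the case $\alpha=0$ (i.e. $P_1=1$), the fraction is understood, after cancelling the common factor $\tau-\beta$, as $\dfrac{\beta}{d\tau}$.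
   Context: A form is a homogeneous polynomial; $F$ is absolutely irreducible if it is irreducible over $\overline{\mathbb{Q}}$. A vector $\mathbf{x}=(x_1,x_2,x_3)\in\mathbb{Z}^3$ is primitive if the highest common factor of $x_1,x_2,x_3$ is $1$. The counting function is $$N(F;\mathbf{P})=\#\{\mathbf{x}\in\mathbb{Z}^3:\ F(\mathbf{x})=0,\ |x_i|\le P_i\ (1\le i\le 3),\ \mathbf{x}\text{ primitive}\}.$$ *)

(* Defs.v *)
From HB Require Import structures.
From mathcomp Require Import all_boot all_order all_algebra all_field.
From mathcomp Require Import finmap mpoly.
From mathcomp Require Import boolp classical_sets functions cardinality.
From mathcomp Require Import reals sequences exp.

Set Implicit Arguments.
Unset Strict Implicit.
Unset Printing Implicit Defensive.

Import Order.TTheory GRing.Theory Num.Theory.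

Local Open Scope ring_scope.
Local Open Scope classical_set_scope.

(* Indices 1, 2, 3 of the mathematics are the elements 0, 1, 2 of 'I_3. *)

Definition irreducible_elt (A : idomainType) (p : A) : Prop :=
  [/\ p != 0, p \isn't a GRing.unit &
      forall q r : A, p = q * r -> q \is a GRing.unit \/ r \is a GRing.unit].

Definition absolutely_irreducible (n : nat) (F : {mpoly int[n]}) : Prop :=
  irreducible_elt (map_mpoly (intr : int -> algC) F).

Definition primitive (x : 'rV[int]_3) : Prop :=
  gcdz (gcdz (x 0 0) (x 0 1)) (x 0 2) = 1.

Definition zeros_in_box (R : realType) (F : {mpoly int[3]}) (P : 'I_3 -> R) :
    set 'rV[int]_3 :=
  [set x : 'rV[int]_3 | [/\ F.@[x 0] = 0, forall i, `|x 0 i|%:~R <= P i & primitive x]].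

(* [fset_set] is the empty set on infinite sets; the count below is therefore
   meaningful because of this lemma. *)
Lemma finite_zeros_in_box (R : realType) (F : {mpoly int[3]})
  (P : 'I_3 -> R) : finite_set (zeros_in_box F P).
Proof.
pose B := \max_(i < 3) Num.truncn (P i).
pose g (f : {ffun 'I_3 -> bool * 'I_B.+1}) : 'rV[int]_3 :=
  \row_i ((-1) ^+ (f i).1 * (f i).2%:Z).
apply: (@sub_finite_set _ _ (g @` setT)); last exact: finite_image.
move=> x [_ xP _]; exists [ffun i => (x 0 i < 0, inord (absz (x 0 i)))] => //.
apply/rowP => i; rewrite mxE ffunE /= inordK; last first.
  rewrite ltnS (leq_trans _ (leq_bigmax i)) //.
  rewrite truncn_ge_nat; first by rewrite -[_%:R]/((_%:Z)%:~R) abszE.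
  by apply: le_trans (xP i); rewrite ler0z.
by rewrite abszE -intEsign.
Qed.

Definition num_zeros (R : realType) (F : {mpoly int[3]}) (P : 'I_3 -> R) : nat :=
  #|` fset_set (zeros_in_box F P)|%fset.

(* All the terms are positive when the P i are, so that starting the maximum
   at 0 is harmless as soon as F != 0. *)
Definition max_monomial (R : realType) (F : {mpoly int[3]}) (P : 'I_3 -> R) : R :=
  \big[Num.max/0]_(m <- msupp F) \prod_(i < 3) P i ^+ m i.

(* For a = 0 the general formula reduces to b / (d t) only when t != b. *)
Definition exponent (R : realType) (d : nat) (a b t : R) : R :=
  if a == 0 then b / (d%:R * t)
  else (a * b + (a + b - a * b) * (t - a - b)) / (d%:R * (t - a) * (t - b)).

(* Main.v *)
Require Import Defs.
From HB Require Import structures.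
From mathcomp Require Import all_boot all_order all_algebra all_field.
From mathcomp Require Import fingroup perm finmap mpoly.
From mathcomp Require Import boolp classical_sets functions cardinality.
From mathcomp Require Import reals sequences exp.
From mathcomp Require Import zify ring lra.

(* Heath-Brown's p-adic determinant method, with interpolation monomials chosen
   according to the shape of the box.
   - By Bezout's theorem the points lie on few curves once an auxiliary form that
     is not a multiple of F is found.  Linear algebra on all monomials of degree d
     gives such a form, or replaces F by an equivalent form G whose coefficients
     are bounded by a power of P_3.
   - Fix j with dG/dx_j <> 0 and k <> j.  Points with x_k dG/dx_j = 0 are few, and
     at any other point x this value is bounded by a power of P_3, so that one of
     O(log P_3) primes p of size about Q does not divide it.  Points in one such
     nonsingular residue class mod p are parametrised p-adically by one variable,
     so an s x s determinant of monomials at s of them is divisible by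
     p^(s(s-1)/2); if Q is large enough the determinant vanishes, and there is a
     form g in the span of the s monomials vanishing on the class.  If no monomial
     is a multiple of the dominant monomial x^m of F then F does not divide g.
     There are at most d p classes.
   - Put L(e) = alpha e_1 + beta e_2 + e_3.  The required size of Q is
     P_3^(2 sum L(e) / s^2).  The monomials of large degree not divisible by x^m
     form three strips along the edges of a triangle; keeping those with
     L(e) <= lambda deg and optimising lambda gives the exponent of the theorem. *)

Set Implicit Arguments.
Unset Strict Implicit.
Unset Printing Implicit Defensive.

Import Order.TTheory GRing.Theory Num.Theory.
Local Open Scope ring_scope.

(** * Unique factorization of multivariate polynomials *)

(** Uniformity shapes the proof. The coefficients of F are unbounded, so the number of primes needed
    to avoid the values of dF/dx_j would depend on F; this is why F gives way to G. The degree of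
    the interpolation monomials is fixed from d and eps before alpha, beta, tau and the dominant
    monomial are known, so that the factorials and the prime counts depend on d and eps only.
    Bezout's theorem is a dimension count: evaluation at the points is onto in large degree, and the
    kernel of (A, B) -> F A + G B is reduced to the multiples of (G, -F) because F is a prime
    element. Absolute irreducibility only says that F has no proper factorisation, hence the unique
    factorisation proved at the outset. Each projective point has two primitive representatives x
    and -x, which accounts for the factor 2 in the point counts. The factor P_3^eps pays in three
    equal parts for the finite degree of the interpolation monomials, for the number of primes, and
    for the logarithm lost in Chebyshev's bound when primes slightly above Q are chosen. *)

Definition divides (A : comNzRingType) (a b : A) := exists c, b = a * c.

Definition prime_elt (A : idomainType) (p : A) :=
  [/\ p != 0, p \isn't a GRing.unit &
      forall a b, divides p (a * b) -> divides p a \/ divides p b].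

Definition factorial_ring (A : idomainType) :=
  forall a : A, a != 0 -> exists u : A, exists s : seq A,
    [/\ u \is a GRing.unit, {in s, forall p, prime_elt p}
      & a = u * \prod_(p <- s) p].


(** A non-unit has at least one prime [p] in its factorisation; irreducibility makes the cofactor a
    unit, so that [f] is associated with [p]. *)
Lemma factorial_irreducible_prime (B : idomainType) (f : B) :
  factorial_ring B -> irreducible_elt f -> prime_elt f.
Proof.
move=> facB [f0 fU firr]; have [u [s [uU sP fE]]] := facB f f0.
case: s sP fE => [|p s] sP fE.
  by move: fU; rewrite fE big_nil mulr1 uU.
have [p0 pU pP] := sP p (mem_head _ _).
have {}fE : f = p * (u * \prod_(q <- s) q) by rewrite fE big_cons mulrCA.
case: (firr _ _ fE) => [|tU]; first by rewrite (negbTE pU).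
split=> // a b [c abE].
have /pP : divides p (a * b).
  by exists (u * \prod_(q <- s) q * c); rewrite abE {1}fE !mulrA.
move: (u * _) fE tU => t fE tU.
by case=> -[e eE]; [left|right]; exists (t^-1 * e);
  rewrite eE fE -!mulrA mulVKr.
Qed.

Section Gauss.
Variable A : idomainType.
Implicit Types (f g : {poly A}) (c : A) (s : seq A).

Lemma divides_polyC (p : {poly A}) c : divides c%:P p <-> forall i, divides c p`_i.
Proof.
split=> [[q ->] i|]; first by rewrite coefCM; exists q`_i.
elim/poly_ind: p => [|p a IHp] cP; first by exists 0; rewrite mulr0.
have [] := IHp.
  by move=> i; move: (cP i.+1); rewrite coefD coefMX coefC /= addr0.
move=> q qE; have [b bE] := cP 0%N.
exists (q * 'X + b%:P); rewrite mulrDr mulrA -qE -rmorphM /= -bE.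
by rewrite coefD coefMX coefC /= add0r.
Qed.

(** Gauss's lemma, by induction on [size f + size g]: [c] divides the product of the constant terms,
    hence one of them; that term can be discarded and the factor 'X removed. *)
Lemma prime_polyC c : prime_elt c -> prime_elt c%:P.
Proof.
move=> [c0 cU cP]; split.
- by rewrite polyC_eq0.
- by rewrite poly_unitE coefC /= (negbTE cU) andbF.
move=> f g; have [n] := ubnP (size f + size g)%N.
elim: n f g => // n IHn f g; rewrite ltnS => leS.
have aux f1 g1 a : (size (f1 * 'X + a%:P)%R + size g1 <= n)%N -> divides c a ->
    divides c%:P ((f1 * 'X + a%:P) * g1) ->
    divides c%:P (f1 * 'X + a%:P) \/ divides c%:P g1.
  move=> leSn [b ->]; have [->|f1N0] := eqVneq f1 0.
    by left; exists b%:P; rewrite mul0r add0r rmorphM.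
  move=> dv; have [||[q qE]|dg] := IHn f1 g1; last by right.
  - move: leSn; rewrite size_MXaddC (negbTE f1N0) /=; lia.
  - apply/divides_polyC => i; move/divides_polyC: dv => /(_ i.+1) [e eE].
    exists (e - (b%:P * g1)`_i.+1).
    rewrite mulrBr -eE mulrDl coefD mulrAC coefMX /=.
    by rewrite rmorphM /= -mulrA -coefCM addrK.
  - by left; exists (q * 'X + b%:P); rewrite qE mulrDr rmorphM /= mulrA.
have eq_f := poly_take_drop 1 f.
have dropE (h : {poly A}) : h = drop_poly 1 h * 'X + (h`_0)%:P.
  rewrite -[LHS](poly_take_drop 1) addrC expr1; congr (_ + _).
  apply/polyP => i; rewrite coef_take_poly coefC; by case: i.
move=> dv; have /cP[dc|dc] : divides c (f`_0 * g`_0).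
- by move/divides_polyC: dv => /(_ 0%N); rewrite coef0M.
- by rewrite (dropE f); apply: aux; rewrite -?dropE.
- rewrite (dropE g) or_comm; apply: aux; rewrite -?dropE // 1?mulrC //.
  by rewrite addnC.
Qed.

(** A prime constant dividing [f * q] divides [q], and so cancels: if it divided the irreducible
    [f], the cofactor would be a unit and [f] a constant. *)
Lemma irreducible_dvd_cancel f g s : {in s, forall p, prime_elt p} ->
  irreducible_elt f -> (1 < size f)%N ->
  divides f ((\prod_(p <- s) p)%:P * g) -> divides f g.
Proof.
move=> + firr szf; elim: s g => [|p s IHs] g sP.
  by rewrite big_nil mul1r.
rewrite big_cons rmorphM /= -mulrA => -[q qE].
have := prime_polyC (sP p (mem_head _ _)) => -[p0 pU pP].
have [] := pP f q; first by exists ((\prod_(j <- s) j)%:P * g).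
  case=> e eE; case: firr => _ _ /(_ _ _ eE) [|eU].
    by rewrite (negbTE pU).
  move: szf; rewrite eE size_Cmul -?(polyC_eq0 p) //.
  by move: eU; rewrite poly_unitE => /andP[/eqP->].
case=> e eE; apply: IHs; first by move=> r rs; apply: sP; rewrite in_cons rs orbT.
exists e; apply: (mulfI p0); rewrite qE eE; by rewrite mulrCA.
Qed.

(** Each prime of [s] divides [r] or [q] and is cancelled there; the primes taken out of [r] make up
    [e], and what remains of [r] divides [f]. *)
Lemma primitive_factor f r q c s : {in s, forall p, prime_elt p} ->
  c \is a GRing.unit -> f != 0 ->
  (c * \prod_(p <- s) p)%:P * f = r * q ->
  exists e r1 q1, [/\ e != 0, r = e%:P * r1 & f = r1 * q1].
Proof.
move=> + cU f0; elim: s r q => [|p s IHs] r q sP.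
  rewrite big_nil mulr1 => E; exists 1, r, (c^-1%:P * q).
  rewrite oner_neq0 mul1r; split=> //.
  by rewrite mulrCA -E mulrA -rmorphM /= mulVr // mul1r.
rewrite big_cons mulrCA rmorphM /= -mulrA => E.
have pp := sP p (mem_head _ _).
have [p0 _ _] := pp.
have [pC0 _ pP] := prime_polyC pp.
have sP' : {in s, forall p, prime_elt p}.
  by move=> t ts; apply: sP; rewrite in_cons ts orbT.
have [] := pP r q; first by exists ((c * \prod_(j <- s) j)%:P * f).
  case=> r' r'E; have [|e [r1 [q1 [e0 rE fE]]]] := IHs r' q sP'.
    by apply: (mulfI pC0); rewrite E r'E mulrA.
  by exists (p * e), r1, q1; rewrite mulf_neq0 // r'E rE rmorphM mulrA.
case=> q' q'E; apply: (IHs r q' sP'); apply: (mulfI pC0).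
by rewrite E q'E mulrCA.
Qed.

Hypothesis facA : factorial_ring A.

(* If f divides g h but not g, consider an element r of least degree of the ideal
   (f, g).  If r is a constant then f divides r h, hence h; otherwise r divides
   constant multiples of both f and g, so that r is a constant multiple of f. *)
Lemma irreducible_poly_prime f : irreducible_elt f -> (1 < size f)%N ->
  prime_elt f.
Proof.
move=> firr szf; have [f0 fU fI] := firr; split=> // g h fgh.
have [?|fNg] := pselect (divides f g); [by left|right].
pose I r := exists a b, r = a * f + b * g.
have cancel c k : c != 0 -> divides f (c%:P * k) -> divides f k.
  move=> c0; have [u [s [uU sP ->]]] := facA c0.
  rewrite rmorphM /= -mulrA => -[q qE]; apply: (@irreducible_dvd_cancel _ _ s) => //.
  exists (u^-1%:P * q); apply: (@mulfI _ u%:P).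
    by rewrite polyC_eq0; apply: contraTneq uU => ->; rewrite unitr0.
  by rewrite qE mulrCA (mulrA u%:P) -rmorphM /= divrr // mul1r.
have exI : exists n, `[< exists r, [/\ I r, r != 0 & size r = n] >].
  exists (size f); apply/asboolP; exists f; split=> //.
  by exists 1, 0; rewrite mul1r mul0r addr0.
case: (ex_minnP exI) => n /asboolP[r [Ir r0 szr]] rmin.
have minI r' : I r' -> (size r' < size r)%N -> r' = 0.
  move=> Ir' lt; apply/eqP/negPn/negP => r'0.
  have : (n <= size r')%N by apply: rmin; apply/asboolP; exists r'.
  by rewrite -szr leqNgt lt.
have [szr1|szr1] := leqP (size r) 1.
  have rE := size1_polyC szr1; apply: (cancel r`_0).
    by rewrite -polyC_eq0 -rE.
  rewrite -rE; case: Ir => a [b ->]; case: fgh => c cE.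
  by exists (a * h + b * c); rewrite mulrDl -[b * g * h]mulrA cE; ring.
exfalso; apply: fNg.
have divI k : I k -> exists e t, e != 0 /\ e%:P * k = r * t.
  move=> Ik; have := Pdiv.Idomain.divp_eq k r.
  set e := lead_coef r ^+ _; exists e, (k %/ r); split.
    by rewrite expf_neq0 // lead_coef_eq0.
  have km : k %% r = 0.
    apply: minI; last by rewrite Pdiv.Idomain.ltn_modp.
    have [a [b kE]] := Ik; have [a' [b' rE]] := Ir.
    exists (e%:P * a - (k %/ r) * a'), (e%:P * b - (k %/ r) * b').
    have -> : k %% r = e%:P * k - (k %/ r) * r.
      by rewrite mul_polyC [_ *: k]H addrC addKr.
    by rewrite {1}kE {2}rE; ring.
  by rewrite mul_polyC [_ *: k]H km addr0 mulrC.
have [e [t [e0 E]]] : exists e t, e != 0 /\ e%:P * f = r * t.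
  by apply: divI; exists 1, 0; rewrite mul1r mul0r addr0.
have [u [s [uU sP eE]]] := facA e0.
have [c [r1 [q1 [c0 rE fE]]]] : exists e r1 q1, [/\ e != 0, r = e%:P * r1 & f = r1 * q1].
  by apply: (@primitive_factor f r t u s) => //; rewrite -eE.
have [e' [t' [e'0 E']]] : exists e t, e != 0 /\ e%:P * g = r * t.
  by apply: divI; exists 0, 1; rewrite mul1r mul0r add0r.
have q1U : q1 \is a GRing.unit.
  case: (fI _ _ fE) => //; rewrite poly_unitE => /andP[/eqP r1s _].
  by move: szr1; rewrite rE size_Cmul // r1s.
apply: (cancel e') => //; rewrite E' rE.
exists (c%:P * t' * q1^-1); move: (q1^-1) (mulrV q1U) => v q1v.
transitivity (c%:P * r1 * t' * (q1 * v)); first by rewrite q1v mulr1.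
by rewrite fE; ring.
Qed.

(** The outer induction is on the size, the inner one on the number of primes in the leading
    coefficient. A prime constant dividing [f] shortens the latter; without one, [f] is irreducible
    or splits into two factors of smaller size. *)
Lemma factorial_poly : factorial_ring {poly A}.
Proof.
move=> f; have [n] := ubnP (size f); elim: n f => // n IHn f; rewrite ltnS => szf f0.
have [|szf1] := leqP (size f) 1.
  move=> /size1_polyC fE; have := f0; rewrite fE polyC_eq0 => /facA[u [s [uU sP ->]]].
  exists u%:P, [seq p%:P | p <- s]; split.
  - by rewrite poly_unitE coefC /= uU andbT size_polyC; case: (u =P 0) uU => // ->; rewrite unitr0.
  - by move=> _ /mapP[p ps ->]; apply/prime_polyC/sP.
  - by rewrite big_map rmorphM rmorph_prod.
pose fac (g : {poly A}) := exists (u : {poly A}) (s : seq {poly A}),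
  [/\ u \is a GRing.unit, {in s, forall p, prime_elt p} & g = u * \prod_(p <- s) p].
have mulfac g h : fac g -> fac h -> fac (g * h).
  move=> [u [s [uU sP ->]]] [v [t [vU tP ->]]]; exists (u * v), (s ++ t).
  split; first by rewrite unitrM uU.
    by move=> p; rewrite mem_cat => /orP[/sP|/tP].
  by rewrite big_cat /= mulrACA.
have := lead_coef_eq0 f; rewrite (negbTE f0) => /negbT /facA[u [s [uU sP lE]]].
have [k] := ubnP (size s); elim: k s f szf f0 szf1 lE sP => // k IHs s f szf f0 szf1 lE sP.
rewrite ltnS => szs.
have [[p ps [g gE]]|pNf] := pselect (exists2 p, p \in s & divides p%:P f).
  have [p0 pU _] := sP p ps.
  have szg : size g = size f by rewrite gE size_Cmul.
  rewrite gE; apply: mulfac.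
    exists 1, [:: p%:P]; split; first exact: unitr1.
      by move=> q; rewrite inE => /eqP ->; apply/prime_polyC/sP.
    by rewrite big_seq1 mul1r.
  apply: (IHs (rem p s)); rewrite ?szg //.
  - by rewrite -size_poly_gt0 szg size_poly_gt0.
  - apply: (mulfI p0); have := congr1 lead_coef gE.
    by rewrite lead_coefM lead_coefC => <-; rewrite lE (big_rem p ps) /= mulrCA.
  - by move=> q /mem_rem; apply: sP.
  - by rewrite size_rem //; move: szs; case: (s) ps.
have [/asboolP irr|/asboolPn Nirr] := boolP `[< irreducible_elt f >].
  exists 1, [:: f]; split; first exact: unitr1.
    by move=> p; rewrite inE => /eqP ->; apply: irreducible_poly_prime.
  by rewrite big_seq1 mul1r.
have [g [h [fE gU hU]]] : exists g h, [/\ f = g * h, g \isn't a GRing.unit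
    & h \isn't a GRing.unit].
  apply: contrapT => Nex; apply: Nirr; split=> //.
    by rewrite poly_unitE gtn_eqF.
  move=> g h fE; apply: contrapT => /not_orP[gU hU]; apply: Nex.
  by exists g, h; split=> //; apply/negP.
have [g0 h0] : g != 0 /\ h != 0 by apply/andP; rewrite -negb_or -mulf_eq0 -fE.
(* If [a] were constant, a prime [q] of it would divide the leading coefficient of [f], hence be
   associated with a prime of [s], which would then divide [f]. *)
have size_gt1 (a b : {poly A}) : f = a * b -> a \isn't a GRing.unit -> a != 0 ->
    (1 < size a)%N.
  move=> abE aU a0; rewrite ltnNge; apply/negP => /size1_polyC aE.
  have := a0; rewrite aE polyC_eq0 => /facA[v [t [vU tP a0E]]].
  case: t tP a0E => [|q t] tP a0E.
    move: aU; rewrite aE a0E big_nil mulr1 poly_unitE coefC /= vU andbT size_polyC.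
    by case: (v =P 0) vU => // ->; rewrite unitr0.
  have [q0 qU qP] := tP q (mem_head _ _).
  have qf : divides q%:P f.
    exists ((v * \prod_(j <- t) j)%:P * b); rewrite abE aE a0E big_cons mulrCA.
    by rewrite !rmorphM /= !mulrA.
  have : divides q (u * \prod_(p <- s) p).
    by rewrite -lE lead_coefE; move/divides_polyC: qf; apply.
  case/qP => [[w uE]|].
    by move: uU; rewrite uE unitrM (negbTE qU).
  have pNf' p : p \in s -> ~ divides p%:P f by move=> ps pf; apply: pNf; exists p.
  elim: (s) sP pNf' => [|p s' IH] sP' pNf'.
    rewrite big_nil => -[w wE]; have : q * w \is a GRing.unit by rewrite -wE unitr1.
    by rewrite unitrM (negbTE qU).
  rewrite big_cons => /qP[[w pE]|]; last first.
    by apply: IH => r rs; [apply: sP'|apply: pNf']; rewrite in_cons rs orbT.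
  have [p0 pU pP] := sP' p (mem_head _ _).
  have [] := pP q w; first by exists 1; rewrite -pE mulr1.
    move=> [z qE]; apply: (pNf' p (mem_head _ _)); case: qf => y ->.
    by exists (z%:P * y); rewrite qE rmorphM mulrA.
  move=> [z wE]; move: qU; apply/negP/negPn.
  have : q * z = 1 by apply: (mulfI p0); rewrite mulrCA -wE -pE mulr1.
  by move=> qz; apply/unitrP; exists z; rewrite mulrC qz.
have sg := size_gt1 _ _ fE gU g0.
have sh : (1 < size h)%N by apply: (size_gt1 h g); rewrite 1?mulrC.
have szM : size f = (size g + size h).-1 by rewrite fE size_mul.
by rewrite fE; apply: mulfac; apply: IHn => //; lia.
Qed.
End Gauss.

Lemma factorial_iso (A B : idomainType) (f : {rmorphism A -> B})
  (g : {rmorphism B -> A}) : cancel f g -> cancel g f ->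
  factorial_ring B -> factorial_ring A.
Proof.
move=> fK gK facB a a0.
have /facB[u [s [uU sP E]]] : f a != 0.
  by apply: contraNneq a0 => E; rewrite -(fK a) E rmorph0.
exists (g u), [seq g p | p <- s]; split; first exact: rmorph_unit.
  move=> _ /mapP[p /sP[p0 pU pP] ->]; split.
  - by apply: contraNneq p0 => E'; rewrite -(gK p) E' rmorph0.
  - by apply: contra pU => gpU; rewrite -(gK p) rmorph_unit.
  - move=> b c [e bcE].
    have [] := pP (f b) (f c); first by exists (f e); rewrite -rmorphM bcE rmorphM gK.
    + by case=> q qE; left; exists (g q); rewrite -rmorphM -qE fK.
    + by case=> q qE; right; exists (g q); rewrite -rmorphM -qE fK.
by rewrite big_map -rmorph_prod -rmorphM -E fK.
Qed.

Section MpolyFactorial.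
Variable K : fieldType.

(** Inverse of [muni], which singles out the last variable; the two transport factoriality from
    univariate polynomials. *)
Definition unmuni (n : nat) (q : {poly {mpoly K[n]}}) : {mpoly K[n.+1]} :=
  (map_poly (@mwiden n K) q).['X_ord_max].

Lemma unmuni_is_additive n : additive (@unmuni n).
Proof. by move=> p q; rewrite /unmuni rmorphB hornerD hornerN. Qed.

Lemma unmuni_is_multiplicative n : multiplicative (@unmuni n).
Proof. by split=> [p q|]; rewrite /unmuni ?rmorphM ?hornerM // rmorph1 hornerC. Qed.

HB.instance Definition _ n := GRing.isAdditive.Build _ _ (@unmuni n)
  (@unmuni_is_additive n).
HB.instance Definition _ n := GRing.isMultiplicative.Build _ _ (@unmuni n)
  (@unmuni_is_multiplicative n).

Lemma unmuniD n (p q : {poly {mpoly K[n]}}) : unmuni (p + q) = unmuni p + unmuni q.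
Proof. by rewrite /unmuni rmorphD hornerD. Qed.

Lemma muniX n (m : 'X_{1..n.+1}) : muni ('X_[m] : {mpoly K[n.+1]}) =
  'X_[[multinom m (widen_ord (leqnSn n) i) | i < n]]%:P * 'X^(m ord_max).
Proof.
by rewrite muniE msuppX big_seq1 mcoeffX eqxx scale1r mul_polyC.
Qed.

Lemma muni_monomialK n c (m : 'X_{1..n.+1}) :
  unmuni (muni (c *: 'X_[m] : {mpoly K[n.+1]})) = c *: 'X_[m].
Proof.
rewrite -!mul_mpolyC !rmorphM /= muniC muniX; congr (_ * _).
  by rewrite /unmuni map_polyC hornerC /= mwidenC.
rewrite rmorphM rmorphXn /= /unmuni map_polyC map_polyX hornerC hornerX /= mwidenX.
rewrite mpolyXn -mpolyXD; congr 'X_[_]; apply/mnmP => i; rewrite mnmDE mulmnE mnm1E.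
case: (eqVneq ord_max i) => [<-|ni]; first by rewrite mnmwiden_ordmax mul1n.
have lt_i : (i < n)%N.
  by move: (ltn_ord i) ni; rewrite ltnS leq_eqVlt -val_eqE /= eq_sym => /orP[->|].
have -> : i = widen_ord (leqnSn n) (Ordinal lt_i) by apply: val_inj.
by rewrite mnmwiden_widen mnmE addn0.
Qed.

Lemma muniK n : cancel (@muni n K) (@unmuni n).
Proof.
elim/mpolyind => [|c m p _ _ IHp]; first by rewrite muni0 raddf0.
apply: etrans (congr1 (@unmuni n) (muniD _ _)) _.
apply: etrans (unmuniD _ _) _.
exact: congr2 (muni_monomialK c m) IHp.
Qed.

Lemma unmuniK n : cancel (@unmuni n) (@muni n K).
Proof.
elim/poly_ind => [|p c IHp]; first by rewrite !rmorph0.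
rewrite !rmorphD !rmorphM /= IHp; congr (_ * _ + _).
  rewrite /unmuni map_polyX hornerX muniX mnm1E eqxx expr1.
  rewrite (_ : [multinom _ | i < n] = 0%MM) ?mpolyX0 ?mul1r //.
  apply/mnmP => i; rewrite !mnmE -val_eqE /=.
  by rewrite (gtn_eqF (ltn_ord i)).
rewrite /unmuni map_polyC hornerC /=.
elim/mpolyind: c => [|c m q _ _ IHq]; first by rewrite mwiden0 muni0.
rewrite mwidenD muniD IHq polyCD; congr (_ + _).
rewrite /= mwidenZ muniZ mwidenX muniX mnmwiden_ordmax expr0 mulr1.
rewrite -mul_polyC -rmorphM /= mul_mpolyC; congr (_ *: 'X_[_])%:P.
by apply/mnmP => i; rewrite mnmE mnmwiden_widen.
Qed.

Lemma factorial_mpoly n : factorial_ring {mpoly K[n]}.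
Proof.
elim: n => [|n IHn]; last first.
  exact: factorial_iso (@muniK n) (@unmuniK n) (factorial_poly IHn).
move=> a; rewrite [a]nvar0_mpolyC mpolyC_eq0 -unitfE => aU.
by exists (a@_0)%:MP, [::]; rewrite rmorph_unit //= big_nil mulr1.
Qed.

Lemma irreducible_mpoly_prime n (f : {mpoly K[n]}) :
  irreducible_elt f -> prime_elt f.
Proof. exact/factorial_irreducible_prime/factorial_mpoly. Qed.

End MpolyFactorial.

(** * Bezout's theorem for plane curves *)

Section Bezout.
Variable K : fieldType.

(** Only the component of degree [e] of the quotient contributes to degree [d + e], so the other
    components may be dropped. *)
Lemma divides_dhomog n (F B : {mpoly K[n]}) d e : F \is d.-homog ->
  B \is (d + e).-homog -> divides F B -> exists2 C, C \is e.-homog & B = F * C.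
Proof.
move=> Fd Be [C BE]; exists (pihomog mdeg e C); first exact: pihomogP.
rewrite -[B](pihomog_dE Be) BE.
have [k sk] : exists k, (msize C <= k)%N by exists (msize C).
rewrite [C in LHS](pihomog_partitionE sk) mulr_sumr raddf_sum /=.
have piFC i : pihomog mdeg (d + e) (F * pihomog mdeg i C) =
    if i == e then F * pihomog mdeg e C else 0.
  have hom : F * pihomog mdeg i C \is (d + i).-homog by apply/dhomogM/pihomogP.
  have [->|ie] := eqVneq i e; first by rewrite pihomog_dE //; apply/dhomogM/pihomogP.
  by rewrite (pihomog_ne0 _ hom) // eqn_add2l.
have [lt|ge] := ltnP e k.
  rewrite (bigD1 (Ordinal lt)) //= piFC eqxx big1 ?addr0 // => i.
  by rewrite -val_eqE /= => ie; rewrite piFC (negbTE ie).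
rewrite big1 => [|i _]; last by rewrite piFC ltn_eqF // (leq_trans (ltn_ord i)).
rewrite (_ : pihomog _ _ C = 0) ?mulr0 //; apply/mpolyP => m; rewrite mcoeff0.
have [me|me] := eqVneq (mdeg m) e; last exact: (dhomog_nemf_coeff (pihomogP _ _ _)).
have /eqP : e = e by [].
rewrite pihomogE raddf_sum big_seq_cond big1 // => m' /andP[m'C /eqP m'e].
by have := msize_mdeg_lt m'C; rewrite m'e ltnNge (leq_trans sk).
Qed.

Variables (F G : {mpoly K[3]}) (d D m N : nat) (x : 'I_N -> 'I_3 -> K).
Hypotheses (Fd : F \is d.-homog) (GD : G \is D.-homog).

Fact form_comb_homog (u : dhomog 3 K (D + m) * dhomog 3 K (d + m)) :
  F * val u.1 + G * val u.2 \is (d + (D + m)).-homog.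
Proof.
apply: rpredD; last rewrite addnCA.
  by apply: dhomogM => //; apply: dhomog_is_dhomog.
by apply: dhomogM => //; apply: dhomog_is_dhomog.
Qed.

Definition form_comb u : dhomog 3 K (d + (D + m)) := DHomog (form_comb_homog u).

Fact form_comb_is_linear : linear form_comb.
Proof.
move=> a u v; apply: val_inj => /=; rewrite !mulrDr -!scalerAr scalerDr.
by rewrite !addrA; congr (_ + _); rewrite -!addrA; congr (_ + _); rewrite addrC.
Qed.
HB.instance Definition _ := GRing.isLinear.Build K _ _ _ form_comb form_comb_is_linear.

Fact form_syzygy_homog1 (c : dhomog 3 K m) : G * val c \is (D + m).-homog.
Proof. by apply: dhomogM => //; apply: dhomog_is_dhomog. Qed.

Fact form_syzygy_homog2 (c : dhomog 3 K m) : - (F * val c) \is (d + m).-homog.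
Proof. by rewrite dhomogN; apply: dhomogM => //; apply: dhomog_is_dhomog. Qed.

(** The Koszul syzygies of F and G. *)
Definition form_syzygy (c : dhomog 3 K m) : dhomog 3 K (D + m) * dhomog 3 K (d + m) :=
  (DHomog (form_syzygy_homog1 c), DHomog (form_syzygy_homog2 c)).

Fact form_syzygy_is_linear : linear form_syzygy.
Proof.
move=> a u v; congr pair; apply: val_inj => /=; rewrite mulrDr -scalerAr //.
by rewrite opprD scalerN.
Qed.
HB.instance Definition _ :=
  GRing.isLinear.Build K _ _ _ form_syzygy form_syzygy_is_linear.

Definition form_evals k (f : dhomog 3 K k) : 'rV[K]_N := \row_a (val f).@[x a].

Fact form_evals_is_linear k : linear (@form_evals k).
Proof. by move=> a u v; apply/rowP => i; rewrite !mxE /= mevalD mevalZ. Qed.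
HB.instance Definition _ k :=
  GRing.isLinear.Build K _ _ _ (@form_evals k) (@form_evals_is_linear k).

Hypothesis x_neq0 : forall a, exists i, x a i != 0.
Hypothesis x_indep : forall a b, a != b ->
  exists i j, x a i * x b j - x a j * x b i != 0.

(** For each other point take a linear form vanishing there but not at [x a]; the product has degree
    N - 1 and is padded with a coordinate that is non-zero at [x a]. *)
Lemma form_separate k a : (N <= k)%N ->
  exists2 f : dhomog 3 K k, (val f).@[x a] != 0 &
    forall b, b != a -> (val f).@[x b] = 0.
Proof.
move=> leNk; have [i0 xi0] := x_neq0 a.
have exl b : exists l : {mpoly K[3]},
    [/\ l \is 1.-homog, l.@[x b] = 0 & b != a -> l.@[x a] != 0].
  have [->|ba] := eqVneq b a.
    by exists 0; rewrite dhomog0 meval0.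
  have [i [j ij]] := x_indep ba.
  exists (x b i *: 'X_j - x b j *: 'X_i); split.
  - by rewrite rpredB ?rpredZ // dhomogX /= mdeg1.
  - by rewrite mevalB !mevalZ !mevalXU mulrC subrr.
  - by move=> _; rewrite mevalB !mevalZ !mevalXU.
have [l lP] := choice exl.
have l1 b : l b \is 1.-homog by case: (lP b).
have lb b : (l b).@[x b] = 0 by case: (lP b).
have la b : b != a -> (l b).@[x a] != 0 by case: (lP b).
pose g := \prod_(b | b != a) l b * 'X_i0 ^+ (k - \sum_(b : 'I_N | b != a) 1).
have gk : g \is k.-homog.
  have le : (\sum_(b : 'I_N | b != a) 1 <= k)%N.
    rewrite sum1_card (leq_trans _ leNk) //.
    by rewrite -[X in (_ <= X)%N]card_ord max_card.
  rewrite -[X in X.-homog](subnKC le) dhomogM //; last first.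
    by rewrite -[X in X.-homog]mul1n dhomogMn // dhomogX /= mdeg1.
  elim/big_rec2: _ => [|b p q _ qh]; first exact: dhomog1.
  by rewrite dhomogM.
exists (DHomog gk) => /=; rewrite /g.
  rewrite mevalM mulf_neq0 //.
    by rewrite rmorph_prod; apply/prodf_neq0 => b /la.
  by rewrite rmorphXn /= mevalXU expf_neq0.
move=> b ba; rewrite mevalM rmorph_prod (bigD1 b) //= lb !mul0r //.
Qed.

Lemma form_evals_limg k : (N <= k)%N -> limg (linfun (@form_evals k)) = fullv.
Proof.
move=> leNk; apply/eqP; rewrite eqEsubv subvf /=; apply/subvP => v _.
have exf a : exists f : dhomog 3 K k, (val f).@[x a] != 0 /\
    forall b, b != a -> (val f).@[x b] = 0.
  by have [f ? ?] := form_separate a leNk; exists f.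
have [f fP] := choice exf.
apply/memv_imgP; exists (\sum_a (v 0 a / (val (f a)).@[x a]) *: f a); first exact: memvf.
rewrite lfunE /= linear_sum /=; apply/rowP => b; rewrite summxE (bigD1 b) //=.
have [fb0 _] := fP b.
rewrite linearZ mxE mxE mulfVK // big1 ?addr0 // => a ab.
by rewrite linearZ mxE mxE (fP a).2 1?eq_sym // mulr0.
Qed.

Hypotheses (primeF : prime_elt F) (FNG : ~ divides F G).
Hypotheses (Fx : forall a, F.@[x a] = 0) (Gx : forall a, G.@[x a] = 0).

(* The forms of degree d + D + m vanishing at the N points contain F A + G B for all
   forms A and B, and the syzygies (A, B) of F and G are the multiples of (G, -F). *)
Lemma bezout_dim : (N <= m)%N ->
  (N + 'C(m + D + 2, 2) + 'C(m + d + 2, 2) <= 'C(m + d + D + 2, 2) + 'C(m + 2, 2))%N.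
Proof.
move=> leNm.
have kerP : (lker (linfun form_comb) <= limg (linfun form_syzygy))%VS.
  apply/subvP => -[A B]; rewrite memv_ker lfunE /= => /eqP/(congr1 val) /= E.
  have [F0 FU FP] := primeF.
  have [|//|C Cm BE] := @divides_dhomog _ F (val B) d m Fd.
  - exact: dhomog_is_dhomog.
  - have [|//|//] := FP G (val B).
    by exists (- val A); rewrite mulrN; apply/eqP; rewrite -addr_eq0 addrC E.
  have CNm : - C \is m.-homog by rewrite dhomogN.
  apply/memv_imgP; exists (DHomog CNm); first exact: memvf.
  rewrite lfunE; congr pair; apply: val_inj; rewrite /= ?BE ?mulrN ?opprK //.
  apply: (mulfI F0); apply/eqP; rewrite mulrN -addr_eq0.
  by move: E; rewrite BE mulrCA => ->.
have dimK : (\dim (lker (linfun form_comb)) <= 'C(m + 2, m))%N.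
  apply: leq_trans (dimvS kerP) _.
  apply: leq_trans (leq_addl (\dim (fullv :&: lker (linfun form_syzygy))) _) _.
  by rewrite limg_ker_dim dimvf.
have dimI := limg_ker_dim (linfun form_comb) fullv.
have dimE := limg_ker_dim (linfun (@form_evals (d + (D + m)))) fullv.
have leIE : (\dim (limg (linfun form_comb)) <=
    \dim (lker (linfun (@form_evals (d + (D + m))))))%N.
  apply/dimvS/subvP => _ /memv_imgP[u _ ->]; rewrite memv_ker lfunE /= lfunE.
  apply/eqP/rowP => a; rewrite !mxE /= mevalD !mevalM Fx Gx.
  by rewrite !mul0r addr0.
rewrite form_evals_limg ?capfv in dimE; last by lia.
rewrite capfv !dimvf in dimI dimE.
have e1 : dim (dhomog 3 K (D + m) * dhomog 3 K (d + m))%type =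
  ('C(D + m + 2, D + m) + 'C(d + m + 2, d + m))%N by [].
have e2 : dim 'rV[K]_N = N by rewrite dim_matrix [LHS]mul1n.
have e3 : dim (dhomog 3 K (d + (D + m))) = 'C(d + (D + m) + 2, d + (D + m)) by [].
have binE k : 'C(k + 2, k) = 'C(k + 2, 2) by rewrite -[RHS]bin_sub ?leq_addl // addnK.
move: dimI dimE; rewrite e1 e2 e3 !binE => dimI dimE.
rewrite binE in dimK.
rewrite (addnC m D) (addnC m d) (_ : d + m + D = d + (D + m))%N; last lia.
lia.
Qed.

End Bezout.

(** Apply [bezout_dim] with m = N: the mixed second difference of the quadratic polynomial 'C(m + 2,
    2) for the steps d and D is exactly d D. *)
Lemma bezout (K : fieldType) (F G : {mpoly K[3]}) (d D N : nat)
    (x : 'I_N -> 'I_3 -> K) :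
  F \is d.-homog -> G \is D.-homog -> prime_elt F -> ~ divides F G ->
  (forall a, exists i, x a i != 0) ->
  (forall a b, a != b -> exists i j, x a i * x b j - x a j * x b i != 0) ->
  (forall a, F.@[x a] = 0) -> (forall a, G.@[x a] = 0) -> (N <= d * D)%N.
Proof.
move=> Fd GD pF FNG x0 xi Fx Gx.
have := bezout_dim Fd GD x0 xi pF FNG Fx Gx (leqnn N).
rewrite !bin2 /= !addn2 /= => H.
suff : (2 * N <= 2 * (d * D))%N by rewrite leq_pmul2l.
have two k : ((k.+2 * k.+1)./2 * 2 = k.+2 * k.+1)%N.
  by rewrite muln2 even_halfK // oddM /=; case: (odd k).
move: H; rewrite -(leq_pmul2r (isT : 0 < 2)%N) !mulnDl !two; lia.
Qed.

(** * Primitive integer points *)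

Lemma meval_map_mpoly (A B : comNzRingType) (f : {rmorphism A -> B}) n
    (p : {mpoly A[n]}) (v : 'I_n -> A) :
  (map_mpoly f p).@[fun i => f (v i)] = f p.@[v].
Proof.
elim/mpolyind: p => [|c m p _ _ IH]; first by rewrite (rmorph0 (map_mpoly f)) !meval0 rmorph0.
rewrite rmorphD /= !mevalD IH rmorphD map_mpolyZ map_mpolyX !mevalZ !mevalX.
rewrite rmorphM rmorph_prod /=; congr (_ * _ + _); apply: eq_bigr => i _.
by rewrite rmorphXn.
Qed.

Lemma dhomog_map_mpoly (A B : comNzRingType) (f : {rmorphism A -> B}) n d
    (p : {mpoly A[n]}) : p \is d.-homog -> map_mpoly f p \is d.-homog.
Proof.
move=> /dhomogP pd; apply/dhomogP => m; rewrite mcoeff_msupp mcoeff_map_mpoly => fm.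
apply: pd; rewrite mcoeff_msupp; by apply: contraNneq fm => ->; rewrite raddf0.
Qed.

Lemma primitive_comb (x : 'rV[int]_3) : primitive x ->
  exists c : 'I_3 -> int, \sum_i c i * x 0 i = 1.
Proof.
rewrite /primitive => px.
have [u [v uv]] := Bezoutz (x 0 0) (x 0 1).
have [w [z wz]] := Bezoutz (gcdz (x 0 0) (x 0 1)) (x 0 2).
exists (fun i => if i == 0 then w * u else if i == 1 then w * v else z).
rewrite !big_ord_recl big_ord0 /= -px -wz -uv addr0.
rewrite (_ : lift ord0 ord0 = 1); last exact: val_inj.
rewrite (_ : lift ord0 (lift ord0 ord0) = 2); last exact: val_inj.
by rewrite (_ : ord0 = 0) //; ring.
Qed.

(** A combination of the coordinates of [x] equal to 1 turns proportionality into y = t x with t an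
    integer; by symmetry x = r y, so t is a unit. *)
Lemma primitive_collinear (x y : 'rV[int]_3) : primitive x -> primitive y ->
  (forall i j, x 0 i * y 0 j = x 0 j * y 0 i) -> y = x \/ y = - x.
Proof.
move=> /primitive_comb[c cx] /primitive_comb[e ey] xy.
pose t := \sum_i c i * y 0 i; pose r := \sum_i e i * x 0 i.
have yE i : y 0 i = x 0 i * t.
  rewrite -[LHS]mul1r -cx mulr_suml mulr_sumr; apply: eq_bigr => j _.
  by rewrite -mulrA -xy mulrCA.
have xE i : x 0 i = y 0 i * r.
  rewrite -[LHS]mul1r -ey mulr_suml mulr_sumr; apply: eq_bigr => j _.
  by rewrite -mulrA [y 0 j * _]mulrC xy mulrA mulrC.
have tr1 : t * r = 1.
  rewrite -[RHS]cx mulr_suml; apply: eq_bigr => j _; by rewrite -mulrA -xE.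
have : t \is a GRing.unit by apply/unitrP; exists r; rewrite mulrC tr1.
case/orP => /eqP t1; [left|right]; apply/rowP => i; rewrite ?mxE yE t1 ?mulr1 //.
by rewrite mulrN1.
Qed.

(** Selects one of the two primitive representatives of a projective point. *)
Definition lex_pos (x : 'rV[int]_3) :=
  0 < (if x 0 0 != 0 then x 0 0 else if x 0 1 != 0 then x 0 1 else x 0 2).

Lemma lex_posN (x : 'rV[int]_3) : primitive x -> lex_pos (- x) = ~~ lex_pos x.
Proof.
rewrite /primitive /lex_pos !mxE !oppr_eq0.
case: eqP => [->|/= /eqP x0 _]; last by rewrite oppr_gt0 -leNgt le_eqVlt (negbTE x0).
case: eqP => [->|/= /eqP x0 _]; last by rewrite oppr_gt0 -leNgt le_eqVlt (negbTE x0).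
have [->|x0 _] := eqVneq (x 0 2) 0; first by [].
by rewrite oppr_gt0 -leNgt le_eqVlt (negbTE x0).
Qed.

(** Among the points with a given value of [lex_pos] no two are proportional, so [bezout] bounds
    each of the two halves. *)
Lemma bezout_primitive (F G : {mpoly int[3]}) (d D : nat) (s : seq 'rV[int]_3) :
  F \is d.-homog -> G \is D.-homog ->
  prime_elt (map_mpoly (intr : int -> algC) F) ->
  ~ divides (map_mpoly (intr : int -> algC) F) (map_mpoly intr G) ->
  uniq s -> (forall x, x \in s -> primitive x) ->
  (forall x, x \in s -> F.@[x 0] = 0) -> (forall x, x \in s -> G.@[x 0] = 0) ->
  (size s <= 2 * (d * D))%N.
Proof.
move=> Fd GD pF FNG us ps Fs Gs.
have half (b : bool) : (size [seq x <- s | lex_pos x == b] <= d * D)%N.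
  set t := filter _ _.
  have tP x : x \in t -> [/\ x \in s & lex_pos x = b].
    by rewrite mem_filter => /andP[/eqP].
  have ut : uniq t by rewrite filter_uniq.
  pose y (a : 'I_(size t)) (i : 'I_3) : algC := (nth 0 t a 0 i)%:~R.
  have yt (a : 'I_(size t)) : nth 0 t a \in t by rewrite mem_nth.
  apply: (bezout (dhomog_map_mpoly intr Fd) (dhomog_map_mpoly intr GD) pF FNG (x := y)).
  - move=> a; have [xs _] := tP _ (yt a); apply: contrapT => /forallNP no.
    have [c] := primitive_comb (ps _ xs).
    rewrite big1 // => i _; have /negP/negPn := no i.
    by rewrite /y intr_eq0 => /eqP ->; rewrite mulr0.
  - move=> a a' aa'; apply: contrapT => no.
    have [xs xb] := tP _ (yt a); have [xs' xb'] := tP _ (yt a').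
    have [i j|E|E] := primitive_collinear (ps _ xs) (ps _ xs').
    + apply: contrapT => ne; apply: no; exists i, j.
      by rewrite /y -!intrM -intrB intr_eq0 subr_eq0; apply/eqP.
    + move/eqP: E; rewrite nth_uniq // => /eqP E.
      by move: aa'; rewrite -val_eqE /= E eqxx.
    + move: xb'; rewrite E lex_posN ?xb; [by case: (b)|exact: ps].
  - by move=> a; rewrite /y meval_map_mpoly Fs ?rmorph0 //; case: (tP _ (yt a)).
  - by move=> a; rewrite /y meval_map_mpoly Gs ?rmorph0 //; case: (tP _ (yt a)).
have := count_predC (fun x => lex_pos x == true) s.
rewrite -!size_filter => <-; rewrite mul2n -addnn leq_add //.
apply: leq_trans (half false); rewrite !size_filter sub_count // => x /=.
by rewrite eqb_id eqbF_neg.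
Qed.

(** * Linear algebra over the integers *)

Lemma det_norm_le (R : numDomainType) n (B : 'M[R]_n) (h : 'I_n -> R) :
  (forall i j, `|B i j| <= h j) -> `|\det B| <= n`!%:R * \prod_j h j.
Proof.
move=> Bh; apply: le_trans (ler_norm_sum _ _ _) _.
rewrite -(card_Sn n) mulr_natl -sumr_const.
apply: ler_sum => s _; rewrite normrM normrX normrN1 expr1n mul1r normr_prod.
rewrite [X in _ <= X](reindex_inj (@perm_inj _ s)); apply: ler_prod => i _.
by rewrite normr_ge0 Bh.
Qed.

(* Expanding a vanishing (r+1)-minor that extends a maximal nonvanishing r-minor
   along its last row gives a linear relation among the columns. *)
Lemma minor_kernel (N M : nat) (A : 'M[int]_(N, M)) (H : int) :
  (forall f : 'I_M -> 'I_N, \det (rowsub f A) = 0) ->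
  1 <= H -> (forall i j, `|A i j| <= H) ->
  exists w : 'I_M -> int, [/\ exists j, w j != 0,
    forall i, \sum_j A i j * w j = 0 &
    forall j, `|w j| <= M`!%:Z * H ^+ M].
Proof.
move=> minor0 H1 AH.
pose P r := [exists f : {ffun 'I_r -> 'I_N}, [exists g : {ffun 'I_r -> 'I_M},
  injectiveb g && (\det (mxsub f g A) != 0)]].
have exP : exists r, P r.
  exists 0%N; apply/existsP; have f0 : 'I_0 -> 'I_N by case.
  have g0 : 'I_0 -> 'I_M by case.
  exists (finfun f0); apply/existsP; exists (finfun g0).
  by rewrite det_mx00 andbT; apply/injectiveP => -[].
have leP r : P r -> (r <= M)%N.
  move=> /existsP[f /existsP[g /andP[/injectiveP ginj _]]].
  by have := leq_card _ ginj; rewrite !card_ord.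
case: (ex_maxnP exP leP) => r Pr rmax; move/existsP: (Pr) => [f /existsP[g]].
move=> /andP[/injectiveP ginj det0].
have ltrM : (r < M)%N.
  rewrite ltn_neqAle leP // andbT; apply: contraNneq det0 => rM.
  subst r; have -> : mxsub f g A = col_perm (perm ginj) (rowsub f A).
    by apply/matrixP => i j; rewrite !mxE permE.
  by rewrite col_permE det_mulmx minor0 mul0r.
have [j jg] : exists j, forall k, g k != j.
  apply: contrapT => no; suff : (M <= r)%N by rewrite leqNgt ltrM.
  have /subset_leq_card : (predT : pred 'I_M) \subset codom g.
    apply/fintype.subsetP => j _; apply: contrapT => /negP jn; apply: no; exists j => k.
    by apply: contraNneq jn => <-; apply: codom_f.
  by rewrite cardT size_enum_ord (card_codom ginj) card_ord.
pose ext n (T : Type) (h : 'I_n -> T) t (k : 'I_n.+1) :=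
  if unlift ord_max k is Some a then h a else t.
have extl n (T : Type) (h : 'I_n -> T) t a : ext n T h t (lift ord_max a) = h a.
  by rewrite /ext liftK.
have extm n (T : Type) (h : 'I_n -> T) t : ext n T h t ord_max = t.
  by rewrite /ext unlift_none.
pose g' := ext _ _ g j.
have g'inj : injective g'.
  move=> a b; rewrite /g' /ext.
  case: unliftP => [a' ->|->]; case: unliftP => [b' ->|->] //.
  - by move/ginj ->.
  - by move/eqP; rewrite (negbTE (jg _)).
  - by move/esym/eqP; rewrite (negbTE (jg _)).
pose c (k : 'I_r.+1) : int := (-1) ^+ (r + k) * \det (mxsub f (g' \o lift k) A).
(* As [g'] is injective the sum has at most one term: [w] is supported on the r + 1 chosen columns,
   with cofactors as entries, and its entry at the new column [j] is the maximal minor up to sign,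
   hence non-zero. *)
pose w l := \sum_(k | g' k == l) c k.
have wg k : w (g' k) = c k.
  by rewrite /w (big_pred1 k) // => l; rewrite (inj_eq g'inj).
have H0 : 0 <= H by apply: le_trans H1.
exists w; split.
- exists j; rewrite -(extm _ _ g j) wg /c mulf_neq0 ?signr_eq0 //.
  rewrite (_ : mxsub _ _ _ = mxsub f g A) //; apply/matrixP => a b.
  by rewrite !mxE /= /g' extl.
- move=> i; pose X := mxsub (ext _ _ f i) g' A.
  have detX : \det X = 0.
    apply/eqP/negPn/negP => X0; suff : P r.+1 by move/rmax; rewrite ltnn.
    apply/existsP; exists (finfun (ext _ _ f i)); apply/existsP; exists (finfun g').
    apply/andP; split.
      by apply/injectiveP => a b; rewrite !ffunE => /g'inj.
    rewrite (_ : mxsub _ _ _ = X) //; by apply/matrixP => a b; rewrite !mxE !ffunE.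
  apply: etrans detX; rewrite (expand_det_row X ord_max).
  transitivity (\sum_l \sum_(k | g' k == l) A i l * c k).
    by apply: eq_bigr => l _; rewrite mulr_sumr.
  rewrite (exchange_big_dep xpredT) //=.
  apply: eq_bigr => k _; rewrite (big_pred1 (g' k)) //.
  rewrite !mxE extm /cofactor /c; congr (_ * (_ * \det _)).
  by apply/matrixP => a b; rewrite !mxE /= extl.
- move=> l; have [[k <-]|no] := pselect (exists k, g' k = l); last first.
    rewrite /w big_pred0 => [|k]; last by apply/eqP => E; apply: no; exists k.
    by rewrite normr0 mulr_ge0 // exprn_ge0.
  rewrite wg /c normrM normrX normrN1 expr1n mul1r.
  apply: le_trans (det_norm_le (h := fun=> H) _) _; first by move=> a b; rewrite mxE.
  rewrite prodr_const card_ord; apply: ler_pM => //.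
  + by rewrite exprn_ge0.
  + by rewrite natz lez_nat leq_fact // ltnW.
  + by rewrite ler_weXn2l // ltnW.
Qed.

(** * Congruences and Hensel lifting *)

Section Congruences.
Variable n : int.
Implicit Types a b c d : int.

Lemma dvdzD a b : (n %| a)%Z -> (n %| b)%Z -> (n %| a + b)%Z.
Proof. exact: rpredD. Qed.

Lemma dvdzB a b : (n %| a)%Z -> (n %| b)%Z -> (n %| a - b)%Z.
Proof. exact: rpredB. Qed.

Lemma congzM a b c d : (n %| a - b)%Z -> (n %| c - d)%Z -> (n %| a * c - b * d)%Z.
Proof.
move=> ab cd; rewrite (_ : a * c - b * d = (a - b) * c + b * (c - d)); last by ring.
by apply: dvdzD; [exact: dvdz_mulr|exact: dvdz_mull].
Qed.

Lemma congzD a b c d : (n %| a - b)%Z -> (n %| c - d)%Z -> (n %| (a + c) - (b + d))%Z.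
Proof. by move=> ab cd; rewrite opprD addrACA dvdzD. Qed.

Lemma congzX a b k : (n %| a - b)%Z -> (n %| a ^+ k - b ^+ k)%Z.
Proof. by move=> ab; rewrite subrXX dvdz_mulr. Qed.

Lemma congz_sum (I : Type) (r : seq I) (P : pred I) (F G : I -> int) :
  (forall i, P i -> (n %| F i - G i)%Z) ->
  (n %| \sum_(i <- r | P i) F i - \sum_(i <- r | P i) G i)%Z.
Proof.
move=> FG; elim/big_rec2: _ => [|i b a Pi ab]; first by rewrite subrr dvdz0.
by apply: congzD => //; apply: FG.
Qed.

Lemma congz_prod (I : Type) (r : seq I) (P : pred I) (F G : I -> int) :
  (forall i, P i -> (n %| F i - G i)%Z) ->
  (n %| \prod_(i <- r | P i) F i - \prod_(i <- r | P i) G i)%Z.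
Proof.
move=> FG; elim/big_rec2: _ => [|i b a Pi ab]; first by rewrite subrr dvdz0.
by apply: congzM => //; apply: FG.
Qed.

Lemma congz_det k (A B : 'M[int]_k) :
  (forall i j, (n %| A i j - B i j)%Z) -> (n %| \det A - \det B)%Z.
Proof.
move=> AB; apply: congz_sum => s _; apply: congzM; first by rewrite subrr dvdz0.
exact: congz_prod.
Qed.

Lemma congz_meval k (F : {mpoly int[k]}) (v w : 'I_k -> int) :
  (forall i, (n %| v i - w i)%Z) -> (n %| F.@[v] - F.@[w])%Z.
Proof.
move=> vw; rewrite !mevalE; apply: congz_sum => m _.
apply: congzM; first by rewrite subrr dvdz0.
by apply: congz_prod => i _; apply: congzX.
Qed.

Lemma congz_horner (q : {poly int}) a b : (n %| a - b)%Z -> (n %| q.[a] - q.[b])%Z.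
Proof.
move=> ab; rewrite !horner_coef; apply: congz_sum => i _.
by apply: congzM; [rewrite subrr dvdz0|apply: congzX].
Qed.

Lemma dvdz_congr a b : (n %| a - b)%Z -> (n %| b)%Z -> (n %| a)%Z.
Proof. by move=> ab nb; rewrite -[a](subrK b) dvdzD. Qed.

Lemma congzC a b : (n %| a - b)%Z = (n %| b - a)%Z.
Proof. by rewrite !dvdzE -opprB abszN. Qed.

Lemma congz_trans b a c : (n %| a - b)%Z -> (n %| b - c)%Z -> (n %| a - c)%Z.
Proof. by move=> ab bc; rewrite -[a](subrK b) -addrA dvdzD. Qed.

(** The difference quotient is kept as an integer [r], congruent to the derivative; the exact factor
    [y - z] is what lets a Newton step gain a power of p. *)
Lemma horner_sub_deriv (q : {poly int}) y z v : (n %| y - v)%Z -> (n %| z - v)%Z ->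
  exists2 r, q.[y] - q.[z] = (y - z) * r & (n %| r - q^`().[v])%Z.
Proof.
move=> yv zv; elim/poly_ind: q => [|q c [r qE rq]].
  by exists 0; rewrite ?deriv0 ?horner0 ?mulr0 ?subrr ?dvdz0.
exists (q.[y] + z * r).
  by rewrite !hornerMXaddC mulrDr [_ * (z * r)]mulrCA -qE; ring.
rewrite derivD derivC addr0 derivM derivX mulr1 hornerD hornerMX.
rewrite [_ * v + _]addrC [_ * v]mulrC; apply: congzD; first exact: congz_horner.
exact: congzM.
Qed.

End Congruences.

(* Subtracting the first row from the others leaves a factor x_a - x_0 in each of
   them; the cofactor matrix is again of the same form. *)
Lemma horner_matrix_dvd (p : int) s (g : 'I_s -> {poly int}) (x : 'I_s -> int) :
  (forall a b, (p %| x a - x b)%Z) ->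
  (p ^+ 'C(s, 2) %| \det (\matrix_(a, i) (g i).[x a]))%Z.
Proof.
elim: s g x => [|s IHs] g x px; first by rewrite bin0n expr0 dvd1z.
have exq i : exists q : {poly int}, g i - (g i).[x ord0]%:P = q * ('X - (x ord0)%:P).
  by apply/factor_theorem; rewrite rootE hornerD hornerN hornerC subrr.
have [q qE] := choice exq.
have qv i y : (g i).[y] = (g i).[x ord0] + (y - x ord0) * (q i).[y].
  have := congr1 (horner^~ y) (qE i); rewrite hornerM hornerXsubC hornerD hornerN hornerC.
  by move=> E; rewrite mulrC -E addrC subrK.
(* [L] puts the first row back. It is triangular with diagonal 1 and [x a - x ord0] for the s other
   rows; these supply the p^s by which ['C(s.+1, 2)] exceeds ['C(s, 2)]. *)
pose L := \matrix_(a < s.+1, b < s.+1) ((b == ord0)%:R +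
  (a != ord0)%:R * (b == a)%:R * (x a - x ord0)).
pose M := \matrix_(a < s.+1, i < s.+1) if a == ord0 then (g i).[x ord0] else (q i).[x a].
have -> : \matrix_(a, i) (g i).[x a] = L *m M.
  apply/matrixP => a i; rewrite !mxE qv.
  rewrite (bigD1 ord0) //= !mxE eqxx.
  have [->|a0] := eqVneq a ord0.
    rewrite /= subrr !mulr0 mul0r !addr0 mul1r big1 ?addr0 // => b b0.
    by rewrite !mxE (negbTE b0) eqxx /= add0r !mul0r.
  rewrite /= mulr0 mul0r addr0 mul1r; congr (_ + _).
  rewrite (bigD1 a) //= !mxE (negbTE a0) eqxx add0r !mul1r big1 ?addr0 // => b.
  by case/andP => b0 ba; rewrite !mxE (negbTE b0) (negbTE ba) mulr0 add0r !mul0r.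
have Ltrig : is_trig_mx L.
  apply/is_trig_mxP => a b ab; rewrite mxE.
  have -> : (b == ord0) = false by apply/negbTE; rewrite -lt0n; apply: leq_ltn_trans ab.
  have -> : (b == a) = false by rewrite -val_eqE /= gtn_eqF.
  by rewrite mulr0 mul0r addr0.
rewrite det_mulmx det_trig // binS bin1 exprD [X in (_ %| X)%Z]mulrC.
apply: dvdz_mul.
  rewrite (expand_det_row M ord0); apply: rpred_sum => i _.
  apply: dvdz_mull; apply: dvdz_mull.
  have -> : row' ord0 (col' i M) = \matrix_(a, b) (q (lift i b)).[x (lift ord0 a)].
    by apply/matrixP => a b; rewrite !mxE.
  by apply: IHs.
rewrite big_ord_recl mxE eqxx /= !mul0r addr0 mul1r.
rewrite -[X in p ^+ X]card_ord -prodr_const.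
elim/big_rec2: _ => [|a b c _ bc]; first exact: dvd1z.
apply: dvdz_mul => //; rewrite mxE /= !mul1r eqxx add0r mul1r; exact: px.
Qed.

(* Newton iteration with the fixed approximate inverse b of the derivative, done on
   polynomials in u so that a single phi serves all the solutions (u, v). *)
Lemma hensel (f : {poly {poly int}}) (p u0 v0 b : int) (n : nat) :
  (p %| b * f^`().[v0%:P].[u0] - 1)%Z ->
  exists phi : {poly int}, forall u v, (p %| u - u0)%Z -> (p %| v - v0)%Z ->
    (p ^+ n.+1 %| f.[v%:P].[u])%Z -> (p ^+ n.+1 %| v - phi.[u])%Z.
Proof.
move=> pb.
suff [phi phiP] : exists phi : {poly int}, forall u v, (p %| u - u0)%Z ->
    (p %| v - v0)%Z -> (p ^+ n.+1 %| f.[v%:P].[u])%Z ->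
    (p ^+ n.+1 %| v - phi.[u])%Z /\ (p %| phi.[u] - v0)%Z.
  by exists phi => u v pu pv pf; case: (phiP u v pu pv pf).
elim: n => [|n [phi IH]].
  by exists v0%:P => u v pu pv _; rewrite hornerC subrr dvdz0 expr1.
exists (phi - b%:P * f.[phi]) => u v pu pv pf.
have [|IH1 IH2] := IH u v pu pv; first by apply: dvdz_trans pf; rewrite exprS dvdz_mull.
pose fu := map_poly (horner_eval u) f.
have fuE (w : {poly int}) : f.[w].[u] = fu.[w.[u]].
  by rewrite -[LHS]/(horner_eval u f.[w]) -horner_map.
have [r rE rP] := horner_sub_deriv fu IH2 pv.
have dfu : (p %| fu^`().[v0] - f^`().[v0%:P].[u0])%Z.
  have -> : fu^`().[v0] = f^`().[v0%:P].[u].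
    rewrite /fu deriv_map -[v0 in LHS](hornerC v0 u).
    by rewrite -[LHS]/((map_poly (horner_eval u) f^`()).[horner_eval u v0%:P]) horner_map.
  exact: congz_horner.
have br : (p %| b * r - 1)%Z.
  apply: congz_trans pb; apply: congzM; first by rewrite subrr dvdz0.
  exact: congz_trans dfu.
have pf' : (p %| f.[phi].[u])%Z.
  rewrite fuE -[fu.[_]](subrK fu.[v]) rE dvdzD //.
    by rewrite dvdz_mulr // -[phi.[u]](subrK v0) -addrA dvdzD // congzC.
  rewrite -[v](hornerC v u) -fuE; apply: dvdz_trans pf; by rewrite exprS dvdz_mulr.
rewrite hornerD hornerN hornerM hornerC; split; last first.
  by rewrite addrAC dvdzB // dvdz_mull.
(* Here p divides 1 - b r and the previous power of p divides v - phi(u), so the product gains one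
   power. *)
have -> : v - (phi.[u] - b * f.[phi].[u]) =
    (v - phi.[u]) * (1 - b * r) + b * f.[v%:P].[u].
  by rewrite !fuE hornerC -[fu.[phi.[u]]](subrK fu.[v]) rE; ring.
apply: dvdzD; last exact: dvdz_mull.
by rewrite exprSr dvdz_mul // congzC.
Qed.

(** * Determinants of monomials at points in one residue class *)

Lemma dhomog_meval (A : comNzRingType) n d (F : {mpoly A[n]}) (y : A) (v : 'I_n -> A) :
  F \is d.-homog -> F.@[fun l => y * v l] = y ^+ d * F.@[v].
Proof.
move=> /dhomogP Fd; rewrite !mevalE mulr_sumr; apply: eq_big_seq => m /Fd /= <-.
rewrite mulrCA; congr (_ * _).
by rewrite mdegE -prodrXr -big_split; apply: eq_bigr => l _; rewrite exprMn.
Qed.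

Lemma dhomog_mderiv (A : comNzRingType) n d (F : {mpoly A[n]}) j :
  F \is d.-homog -> F^`M(j) \is d.-1.-homog.
Proof.
move=> /dhomogP Fd; apply/dhomogP => m; rewrite mcoeff_msupp mcoeff_mderiv => Fm.
have /Fd /= <- : (m + U_(j))%MM \in msupp F.
  by rewrite mcoeff_msupp; apply: contraNneq Fm => ->; rewrite mul0rn.
by rewrite mdegD mdeg1 addn1.
Qed.

Section Dehomogenization.
Variables (i j : 'I_3).
Hypothesis ij : i != j.

(* The third coordinate is set to 1; the inner variable is x_i, the outer one x_j. *)
Definition dehom (F : {mpoly int[3]}) : {poly {poly int}} :=
  mmap (polyC \o polyC) (fun l => if l == i then 'X%:P else if l == j then 'X else 1) F.

Lemma prod_ij (A : comNzRingType) (u v : A) (m : 'I_3 -> nat) :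
  \prod_l (if l == i then u else if l == j then v else 1) ^+ m l = u ^+ m i * v ^+ m j.
Proof.
have ji : (j == i) = false by rewrite eq_sym; exact: negbTE.
rewrite (bigD1 i) //= eqxx (bigD1 j) ?ji //= eqxx.
rewrite big1 ?mulr1 // => l /andP[li lj].
by rewrite (negbTE li) (negbTE lj) expr1n.
Qed.

Lemma dehomX c m : dehom (c *: 'X_[m]) = c%:P%:P * ('X ^+ m i)%:P * 'X ^+ m j.
Proof. by rewrite /dehom mmapZ mmapX /mmap1 prod_ij mulrA rmorphXn. Qed.

Lemma dehom_horner F u v : (dehom F).[v%:P].[u] =
  F.@[fun l => if l == i then u else if l == j then v else 1].
Proof.
elim/mpolyind: F => [|c m F _ _ IH]; first by rewrite /dehom mmap0 !horner0 meval0.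
rewrite {1}/dehom mmapD -!/(dehom _) !hornerD IH mevalD; congr (_ + _).
rewrite dehomX mevalZ mevalX prod_ij.
by rewrite !(hornerM, horner_exp, hornerC, hornerX) mulrA.
Qed.

Lemma dehom_deriv F : (dehom F)^`() = dehom F^`M(j).
Proof.
elim/mpolyind: F => [|c m F _ _ IH]; first by rewrite mderiv0 /dehom mmap0 deriv0.
rewrite {1}/dehom mmapD -!/(dehom _) derivD IH mderivD [RHS]mmapD; congr (_ + _).
rewrite -/(dehom _) dehomX mderivZ mderivX scalerA dehomX.
rewrite -rmorphM /= mul_polyC derivZ derivXn -mul_polyC rmorphM /=.
rewrite !mnmBE !mnm1E (eq_sym j) (negbTE ij) eqxx subn0 subn1 !rmorphM /= !rmorph_nat.
by rewrite -mulr_natr; ring.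
Qed.

End Dehomogenization.

Lemma ord3_third (i j k l : 'I_3) :
  i != j -> k != i -> k != j -> l != i -> l != j -> l = k.
Proof.
move=> ij ki kj li lj; apply/eqP; move: ij ki kj li lj; rewrite -!val_eqE.
by case: i j k l => [[|[|[|]]]//= ?] [[|[|[|]]]//= ?] [[|[|[|]]]//= ?] [[|[|[|]]]//= ?].
Qed.

Lemma coprime_inv_exp (p x : int) n : coprimez p x ->
  exists y, (p ^+ n %| y * x - 1)%Z.
Proof.
move=> cpx; have [u [v uv]] := Bezoutz (p ^+ n) x.
have /eqP c1 : gcdz (p ^+ n) x == 1 by rewrite -[_ == _]/(coprimez _ _) coprimezXl.
exists v; apply/dvdzP; exists (- u); rewrite -c1 -uv; ring.
Qed.

(** Scaling row a by y_a^D, with y_a inverse to the k-th coordinate modulo p^(n+1), turns the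
    entries into monomials at affine points (u_a, v_a). By [hensel], v_a is congruent to a fixed
    polynomial in u_a, so the matrix is congruent to one of polynomial values at arguments that
    agree modulo p, to which [horner_matrix_dvd] applies. *)
Lemma class_det_dvd (F : {mpoly int[3]}) (d D : nat) (i j k : 'I_3) (p s : nat)
    (x : 'I_s -> 'I_3 -> int) (E : 'I_s -> 'X_{1..3}) :
  prime p -> F \is d.-homog -> i != j -> k != i -> k != j ->
  (forall a, F.@[x a] = 0) -> (forall a, ~~ (p %| x a k)%Z) ->
  (forall a, ~~ (p %| F^`M(j).@[x a])%Z) ->
  (forall a b, (p %| x a i * x b k - x b i * x a k)%Z) ->
  (forall a b, (p %| x a j * x b k - x b j * x a k)%Z) ->
  (forall e, mdeg (E e) = D) ->
  (p%:Z ^+ 'C(s, 2) %| \det (\matrix_(a, e) \prod_l x a l ^+ E e l))%Z.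
Proof.
move=> pr_p Fd ij ki kj Fx xk dFx xik xjk ED.
case: s x E Fx xk dFx xik xjk ED => [|s] x E Fx xk dFx xik xjk ED.
  by rewrite bin0n expr0 dvd1z.
set n := 'C(_, _).
have cop z : ~~ (p %| z)%Z -> coprimez p z.
  by rewrite dvdzE coprimezE /= => pz; rewrite prime_coprime.
have exy a : exists y, (p%:Z ^+ n.+1 %| y * x a k - 1)%Z.
  exact/coprime_inv_exp/cop.
have [y yP] := choice exy.
have yp a : (p %| y a * x a k - 1)%Z.
  by apply: dvdz_trans (yP a); rewrite exprS dvdz_mulr.
pose u a := y a * x a i; pose v a := y a * x a j.
pose pt a l := if l == i then u a else if l == j then v a else 1.
have ptP a l : (p%:Z ^+ n.+1 %| pt a l - y a * x a l)%Z.
  rewrite /pt /u /v; case: eqP => [->|/eqP li]; first by rewrite subrr dvdz0.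
  case: eqP => [->|/eqP lj]; first by rewrite subrr dvdz0.
  by rewrite congzC (ord3_third ij ki kj li lj).
have ptp a l : (p %| pt a l - y a * x a l)%Z.
  by apply: dvdz_trans (ptP a l); rewrite exprS dvdz_mulr.
have same l a b : (p %| x a l * x b k - x b l * x a k)%Z ->
    (p %| y a * x a l - y b * x b l)%Z.
  move=> h; have := dvdz_mull (y a * y b) h.
  have e1 := dvdz_mull (y a * x a l) (yp b).
  have e2 := dvdz_mull (y b * x b l) (yp a).
  move=> e3; rewrite (_ : _ - _ = y a * y b * (x a l * x b k - x b l * x a k)
    - y a * x a l * (y b * x b k - 1) + y b * x b l * (y a * x a k - 1)).
    by apply: dvdzD => //; apply: dvdzB.
  by ring.
have [b bP] : exists b, (p %| b * (dehom i j F)^`().[(v ord0)%:P].[u ord0] - 1)%Z.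
  rewrite dehom_deriv // dehom_horner //.
  have [|b] := @coprime_inv_exp p (F^`M(j).@[pt ord0]) 1; last by exists b.
  apply: cop; apply/negP => pd.
  have /negP := dFx ord0; apply.
  have dd : F^`M(j) \is d.-1.-homog.
    exact: dhomog_mderiv.
  have pd' : (p %| (F^`M(j)).@[fun l => y ord0 * x ord0 l])%Z.
    by apply: dvdz_congr pd; apply: congz_meval => l; rewrite congzC.
  move: pd'; rewrite (dhomog_meval _ _ dd) => pd'.
  (* Multiplying by the (d-1)-st power of the k-th coordinate undoes the scaling modulo p. *)
  have -> : F^`M(j).@[x ord0] =
    x ord0 k ^+ d.-1 * (y ord0 ^+ d.-1 * F^`M(j).@[x ord0]) +
    (1 - (y ord0 * x ord0 k) ^+ d.-1) * F^`M(j).@[x ord0].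
    by rewrite exprMn; ring.
  apply: dvdzD; first exact: dvdz_mull.
  apply: dvdz_mulr; rewrite congzC -[X in _ - X](expr1n _ d.-1); exact: congzX.
have [phi phiP] := hensel n bP.
have fP a : (p%:Z ^+ n.+1 %| (dehom i j F).[(v a)%:P].[u a])%Z.
  rewrite dehom_horner //; apply: dvdz_congr (congz_meval F (ptP a)) _.
  by rewrite (dhomog_meval _ _ Fd) Fx mulr0 dvdz0.
have uvP a : (p%:Z ^+ n.+1 %| v a - phi.[u a])%Z.
  by apply: phiP => //; apply: same.
pose X := \matrix_(a, e) \prod_l x a l ^+ E e l.
pose Y := diag_mx (\row_a y a ^+ D) *m X.
pose Z := \matrix_(a, e) ('X ^+ E e i * phi ^+ E e j : {poly int}).[u a].
have YZ : (p%:Z ^+ n.+1 %| \det Y - \det Z)%Z.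
  apply: congz_det => a e; rewrite /Y mul_diag_mx !mxE.
  have -> : y a ^+ D * \prod_l x a l ^+ E e l = \prod_l (y a * x a l) ^+ E e l.
    by rewrite -(ED e) mdegE -prodrXr -big_split; apply: eq_bigr => l _; rewrite exprMn.
  rewrite hornerM hornerXn horner_exp -(prod_ij ij).
  apply: congz_prod => l _; apply: congzX.
  rewrite congzC; have := ptP a l; rewrite /pt; case: eqP => // _; case: eqP => // -> h.
  by apply: congz_trans h; rewrite congzC; apply: uvP.
have Zdvd : (p%:Z ^+ n %| \det Z)%Z.
  by apply: horner_matrix_dvd => a a'; apply: same.
have Ydvd : (p%:Z ^+ n %| \det Y)%Z.
  apply: dvdz_congr Zdvd; apply: dvdz_trans YZ; by rewrite exprSr dvdz_mulr.
(* The row scaling is undone in the same way: [w] is 1 modulo p^n. *)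
rewrite -/X; pose w := \prod_a (y a * x a k) ^+ D.
have detY : \prod_a x a k ^+ D * \det Y = w * \det X.
  rewrite det_mulmx det_diag mulrA -big_split /=; congr (_ * _).
  by apply: eq_bigr => a _; rewrite mxE exprMn mulrC.
have w1 : (p%:Z ^+ n %| 1 - w)%Z.
  have -> : 1 - w = \prod_(a < s.+1) 1 - w by rewrite big1_eq.
  apply: congz_prod => a _; rewrite -[X in X - _](expr1n _ D); apply: congzX; rewrite congzC.
  by apply: dvdz_trans (yP a); rewrite exprSr dvdz_mulr.
rewrite (_ : \det X = \prod_a x a k ^+ D * \det Y + (1 - w) * \det X).
  by apply: dvdzD; [exact: dvdz_mull|exact: dvdz_mulr].
by rewrite detY; ring.
Qed.

(** * Residue classes on the curve *)

Lemma size_le_fibers (T U : eqType) (f : T -> U) (s : seq T) (B : nat) :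
  (forall u, u \in map f s -> (count (fun x => f x == u) s <= B)%N) ->
  (size s <= B * size (undup (map f s)))%N.
Proof.
move=> fB; have -> : size s = (\sum_(u <- undup (map f s)) count (fun x => f x == u) s)%N.
  under eq_bigr do rewrite -sum1_count big_mkcond.
  rewrite exchange_big /= -sum1_size big_seq [RHS]big_seq; apply: eq_bigr => x xs.
  rewrite (bigD1_seq (f x)) ?undup_uniq ?mem_undup ?map_f //= eqxx big1 ?addn0 // => u.
  by rewrite eq_sym => /negbTE ->.
rewrite -sum1_size big_distrr /= big_seq [X in (_ <= X)%N]big_seq.
by apply: leq_sum => u; rewrite mem_undup muln1; apply: fB.
Qed.

Lemma dvdz_Fp (p : nat) (n : int) : prime p -> (n%:~R == 0 :> 'F_p) = (p %| n)%Z.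
Proof. by move=> pr_p; rewrite -(dvdz_pcharf (pchar_Fp pr_p)). Qed.

(** The projective point modulo p in the affine chart x_k = 1; meaningful when p does not divide
    [x k]. *)
Definition residue_class (p : nat) (i j k : 'I_3) (x : 'I_3 -> int) : 'F_p * 'F_p :=
  ((x i)%:~R / (x k)%:~R, (x j)%:~R / (x k)%:~R).

Lemma residue_class_eq p i j k x y : prime p -> ~~ (p %| x k)%Z -> ~~ (p %| y k)%Z ->
  residue_class p i j k x = residue_class p i j k y ->
  (p %| x i * y k - y i * x k)%Z /\ (p %| x j * y k - y j * x k)%Z.
Proof.
move=> pr_p; rewrite -!(dvdz_Fp _ pr_p) => xk yk [] /eqP e1 /eqP e2.
by split; rewrite rmorphB !rmorphM /= subr_eq0 -eqr_div.
Qed.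

Lemma size_dehom i j d F : i != j -> F \is d.-homog -> (size (dehom i j F) <= d.+1)%N.
Proof.
move=> ij /dhomogP Fd; apply: leq_trans (size_sum _ _ _) _.
apply/bigmax_leqP_seq => m mF _; rewrite /mmap1 prod_ij //.
rewrite -rmorphXn /= mulrA -rmorphM mul_polyC.
apply: leq_trans (size_scale_leq _ _) _; rewrite size_polyXn ltnS.
by rewrite -(Fd m mF) /= mdegE (bigD1 j) //= leq_addr.
Qed.

(* For a given first coordinate u the second one is a root of f(u, Y), which is not
   zero since its derivative does not vanish there. *)
Lemma card_residue_classes (F : {mpoly int[3]}) (d : nat) (i j k : 'I_3) (p : nat)
    (s : seq 'rV[int]_3) :
  prime p -> F \is d.-homog -> i != j -> k != i -> k != j ->
  (forall x, x \in s -> [/\ F.@[x 0] = 0, ~~ (p %| x 0%R k)%Z &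
     ~~ (p %| F^`M(j).@[x 0%R])%Z]) ->
  (size (undup [seq residue_class p i j k (x 0%R) | x : 'rV_3 <- s]) <= d * p)%N.
Proof.
move=> pr_p Fd ij ki kj sP.
set c := undup _.
pose fu (u : 'F_p) : {poly 'F_p} :=
  map_poly (horner_eval u \o map_poly (intr : int -> 'F_p)) (dehom i j F).
have fu_ev (G : {mpoly int[3]}) e (x : 'rV[int]_3) : G \is e.-homog ->
    ~~ (p %| x 0%R k)%Z ->
    (map_poly (horner_eval (residue_class p i j k (x 0%R)).1 \o map_poly (intr : int -> 'F_p))
       (dehom i j G)).[(residue_class p i j k (x 0%R)).2] =
    (x 0%R k)%:~R ^- e * (G.@[x 0])%:~R.
  move=> Ge xk.
  have [y yP] : exists y, (p%:Z ^+ 1 %| y * x 0%R k - 1)%Z.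
    apply: coprime_inv_exp; rewrite coprimezE /= prime_coprime //.
  rewrite expr1 -(dvdz_Fp _ pr_p) rmorphB rmorphM /= subr_eq0 in yP.
  have xk0 : (x 0%R k)%:~R != 0 :> 'F_p by rewrite dvdz_Fp.
  have yE : y%:~R = (x 0%R k)%:~R^-1 :> 'F_p.
    by apply: (mulIf xk0); rewrite mulVf // (eqP yP).
  pose u := y * x 0%R i; pose v := y * x 0%R j.
  rewrite /residue_class /=.
  have uE : (x 0%R i)%:~R / (x 0%R k)%:~R = u%:~R :> 'F_p.
    by rewrite /u rmorphM /= yE mulrC.
  have vE : (x 0%R j)%:~R / (x 0%R k)%:~R = v%:~R :> 'F_p.
    by rewrite /v rmorphM /= yE mulrC.
  rewrite uE vE.
  have -> : (v%:~R : 'F_p) = (horner_eval (u%:~R : 'F_p) \o map_poly (intr : int -> 'F_p)) v%:P.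
    by rewrite /= map_polyC /= /horner_eval hornerC.
  rewrite horner_map /= /horner_eval.
  rewrite horner_map /= dehom_horner //.
  have -> : (x 0%R k)%:~R ^- e * (G.@[x 0])%:~R = (y ^+ e * G.@[x 0])%:~R :> 'F_p.
    by rewrite rmorphM rmorphXn /= yE exprVn.
  apply/eqP; rewrite -subr_eq0 -rmorphB /= dvdz_Fp // -(dhomog_meval _ _ Ge).
  apply: congz_meval => l; case: eqP => [->|/eqP li]; first by rewrite subrr dvdz0.
  case: eqP => [->|/eqP lj]; first by rewrite subrr dvdz0.
  rewrite congzC (ord3_third ij ki kj li lj) -(dvdz_Fp _ pr_p) rmorphB rmorphM /=.
  by rewrite (eqP yP) subrr.
have cP z : z \in c -> [/\ fu z.1 != 0 & root (fu z.1) z.2].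
  rewrite mem_undup => /mapP[x /sP[Fx xk dFx] ->]; split.
    apply: contraNneq dFx => fu0.
    have := fu_ev _ _ x (dhomog_mderiv j Fd) xk.
    rewrite -dehom_deriv // -deriv_map -/(fu _) fu0 deriv0 horner0 => /esym/eqP.
    rewrite mulf_eq0 invr_eq0 expf_eq0 dvdz_Fp // (negbTE xk) andbF /=.
    by rewrite dvdz_Fp.
  by rewrite rootE (fu_ev _ _ _ Fd xk) Fx mulr0.
have szu : (size (undup (map fst c)) <= p)%N.
  apply: leq_trans (uniq_leq_size (undup_uniq _) (s2 := enum 'F_p) _) _.
    by move=> ? _; rewrite mem_enum.
  by rewrite -cardT card_Fp.
apply: leq_trans (size_le_fibers (f := fst) (B := d) _) _; last by rewrite leq_mul2l szu orbT.
move=> u /mapP[z /cP[fz0 _] ->]; rewrite -size_filter.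
have := max_poly_roots fz0 (rs := [seq w.2 | w <- c & w.1 == z.1]).
rewrite size_map => H; rewrite -ltnS; apply: leq_trans (H _ _) _.
- apply/allP => r /mapP[w]; rewrite mem_filter => /andP[/eqP wz /cP[_ rw]] ->.
  by rewrite -wz.
- rewrite map_inj_in_uniq ?filter_uniq ?undup_uniq //.
  move=> w w'; rewrite !mem_filter => /andP[/eqP e1 _] /andP[/eqP e2 _] e3.
  by rewrite [w]surjective_pairing [w']surjective_pairing e1 e2 e3.
- exact: leq_trans (size_poly _ _) (size_dehom ij Fd).
Qed.

(** * Primes in an interval *)

Section PrimeCount.
Local Open Scope nat_scope.

Lemma central_binomial_ge n : 2 ^ n <= 'C(n.*2, n).
Proof.
elim: n => // n IHn; rewrite doubleS binS !binS expnS mul2n -addnn.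
by case: n IHn => [|n] IHn; rewrite ?bin0 //; move: IHn; rewrite !binS; lia.
Qed.

(** In Legendre's formula the term of p^k is floor(2n / p^k) - 2 floor(n / p^k), which is at most 1,
    and 0 once p^k exceeds 2n. *)
Lemma logn_central_binomial p n : prime p ->
  logn p 'C(n.*2, n) <= trunc_log p n.*2.
Proof.
move=> pr_p; have p1 := prime_gt1 pr_p.
have E : logn p 'C(n.*2, n) + (logn p n`!).*2 = logn p (n.*2)`!.
  have le : n <= n.*2 by rewrite -addnn leq_addr.
  rewrite -(bin_fact le) (_ : n.*2 - n = n); last by rewrite -addnn addnK.
  by rewrite !lognM ?muln_gt0 ?fact_gt0 ?bin_gt0 // addnn.
have Fn : logn p n`! = \sum_(1 <= k < n.*2.+1) n %/ p ^ k.
  rewrite logn_fact // [RHS](big_cat_nat (n := n.+1)) //=; last by lia.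
  rewrite [X in _ + X]big_nat_cond [X in _ + X]big1 ?addn0 // => k /andP[/andP[nk _] _].
  by rewrite divn_small // (leq_trans nk) // ltnW // ltn_expl.
suff : logn p (n.*2)`! <= trunc_log p n.*2 + (logn p n`!).*2 by lia.
rewrite Fn logn_fact // -[X in _ + X]mul2n big_distrr /=.
apply: leq_trans (_ : \sum_(1 <= k < n.*2.+1) ((k <= trunc_log p n.*2) + 2 * (n %/ p ^ k)) <= _).
  apply: leq_sum => k _; have [le|gt] := leqP k (trunc_log p n.*2).
    have pk0 : 0 < p ^ k by rewrite expn_gt0 (ltnW p1).
    rewrite -ltnS ltn_divLR // add1n -[(_.+2)]/((1 + _).+1) -{1}mul2n.
    rewrite (_ : (2 * (n %/ p ^ k)).+2 = 2 * (n %/ p ^ k).+1); last by lia.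
    by rewrite -mulnA ltn_pmul2l // ltn_ceil.
  rewrite divn_small //; have := trunc_log_ltn n.*2 p1; move/leq_trans; apply.
  by rewrite leq_exp2l.
rewrite big_split /= leq_add2r.
have -> M L : \sum_(1 <= k < M.+1) (k <= L) = minn M L.
  elim: M => [|M IH]; first by rewrite big_geq // min0n.
  by rewrite big_nat_recr //= IH; lia.
exact: geq_minr.
Qed.

(** Chebyshev's argument: every prime power in the factorisation of the central binomial coefficient
    is at most 2n. *)
Lemma prime_count n : 2 ^ n <= n.*2 ^ size [seq p <- iota 0 n.*2.+1 | prime p].
Proof.
case: n => [|n]; first by [].
set N := n.+1; apply: leq_trans (central_binomial_ge N) _.
have le : N <= N.*2 by rewrite -addnn leq_addr.
have C0 : 0 < 'C(N.*2, N) by rewrite bin_gt0.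
apply: leq_trans (_ : N.*2 ^ size (primes 'C(N.*2, N)) <= _).
  have -> s : N.*2 ^ size s = \prod_(p <- s) N.*2.
    by rewrite big_const_seq count_predT iter_muln_1.
  rewrite {1}(prod_prime_decomp C0) prime_decompE big_map [leqLHS]big_seq [leqRHS]big_seq.
  apply: leq_prod => p; rewrite mem_primes => /and3P[pr_p _ _].
  apply: leq_trans (_ : p ^ trunc_log p N.*2 <= _).
    by rewrite leq_exp2l ?prime_gt1 // logn_central_binomial.
  by rewrite trunc_logP ?prime_gt1.
rewrite leq_exp2l; last by rewrite /N doubleS.
apply: uniq_leq_size; first exact: primes_uniq.
move=> p; rewrite mem_primes mem_filter mem_iota => /and3P[pr_p _ pC].
rewrite pr_p /= add0n ltnS leqNgt; apply/negP => lt.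
have : p %| (N.*2)`! by rewrite -(bin_fact le) dvdn_mulr.
rewrite fact_prod Euclid_dvd_prod // big_has => /hasP[k]; rewrite mem_index_iota => /andP[k0 kN] pk.
by have := dvdn_leq k0 pk; rewrite leqNgt (leq_ltn_trans _ lt).
Qed.

Lemma primes_in_interval q r k : 0 < k -> q + r <= 2 ^ k ->
  exists ps : seq nat, [/\ uniq ps, size ps = r &
    {in ps, forall p, prime p && (q < p <= 16 * (2 ^ k * k))}].
Proof.
(* The choice of [t] ensures 2 a <= 2^t <= 16 k. There are at least 2^(a-1) / a >= 2^k >= q + r
   primes up to 2^a = 2^k 2^t, and at most q of them are <= q. *)
move=> k0 qrk; pose t := trunc_log 2 k + 4; pose a := k + t.
have tk : 2 ^ t <= 16 * k.
  by rewrite /t expnD mulnC leq_mul2l /= trunc_logP.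
have kt : a.*2 <= 2 ^ t.
  have := trunc_log_ltn k (isT : 1 < 2); have := ltn_expl (trunc_log 2 k) (isT : 1 < 2).
  by rewrite /a /t expnS expnD; lia.
pose n := 2 ^ a.-1.
have a0 : 0 < a by rewrite addn_gt0 k0.
have n2 : n.*2 = 2 ^ a by rewrite -mul2n -expnS prednK.
have := prime_count n; rewrite n2 -expnM leq_exp2l //.
set P := filter _ _ => cnt.
have qrP : q + r <= size P.
  rewrite -(leq_pmul2l a0); apply: leq_trans cnt.
  rewrite -(leq_pmul2l (isT : 0 < 2)) [2 * n]mul2n n2 mulnA mul2n mulnC.
  by rewrite /a expnD leq_mul.
pose big := [seq p <- P | q < p].
have rbig : r <= size big.
  have : size [seq p <- P | ~~ (q < p)] <= q.
    rewrite -[leqRHS](size_iota 1 q).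
    apply: uniq_leq_size; first by rewrite !filter_uniq ?iota_uniq.
    move=> p; rewrite !mem_filter !mem_iota -leqNgt => /and3P[pq pr_p _].
    by rewrite (prime_gt0 pr_p) add1n ltnS.
  have : size big + size [seq p <- P | ~~ (q < p)] = size P.
    by rewrite -(count_predC (fun p => q < p) P) -!size_filter.
  by move: qrP; lia.
exists (take r big); split.
- by rewrite take_uniq // !filter_uniq // iota_uniq.
- by rewrite size_take_min; apply/minn_idPl.
- move=> p /mem_take; rewrite !mem_filter mem_iota => /and3P[qp -> /=].
  rewrite qp add0n ltnS => /leq_trans; apply.
  by rewrite /a expnD mulnCA leq_mul2l tk orbT.
Qed.
End PrimeCount.

(** * The optimal exponent *)

Section Exponent.
Variable R : realType.
Implicit Types a b t x y : R.

(* S and W / 2 are the normalised number and total weight of the monomials in the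
   three strips when the strips along x_1 = 0 and x_2 = 0 are cut at the fractions x
   and y of their length.  The minimum of W / S ^ 2 is reached when both are cut at
   the same weight l = v / u. *)
Lemma exponent_attained (m1 m2 m3 d : nat) a b t :
  (0 < d)%N -> d = (m1 + m2 + m3)%N -> 0 <= a -> a <= b -> b <= 1 -> a + b <= t -> 0 < t ->
  d%:R * t = a * m1%:R + b * m2%:R + m3%:R ->
  exists x y, let S := m3%:R + m1%:R * x + m2%:R * y in
    [/\ 0 <= x <= 1, 0 <= y <= 1, 1 <= S &
      m3%:R * (a + b) + m1%:R * (2 * b * x + (1 - b) * x ^+ 2)
        + m2%:R * (2 * a * y + (1 - a) * y ^+ 2) <= exponent d a b t * S ^+ 2].
Proof.
move=> d0 dE a0 ab b1 abt t0 dtE.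
have dR : d%:R = m1%:R + m2%:R + m3%:R :> R by rewrite dE !natrD.
have dR0 : 0 < d%:R :> R by rewrite ltr0n.
have [m10 m20 m30] : [/\ 0 <= m1%:R :> R, 0 <= m2%:R :> R & 0 <= m3%:R :> R] by [].
have t1 : t <= 1.
  rewrite -(ler_pM2l dR0) dtE dR mulr1; nra.
have m3_ge1 : m3%:R != 0 :> R -> 1 <= m3%:R :> R.
  by rewrite pnatr_eq0 -lt0n ler1n.
rewrite /exponent; have [az|an0] := eqVneq a 0.
  rewrite az !(mul0r, add0r) in dtE abt *.
  (* For t = b the whole strips are kept, with S = d and equality in the bound; the cut of the other
     case would give S = d b, possibly less than 1. *)
  move: abt; rewrite le_eqVlt => /orP[/eqP bt|bt].
    exists 1, 1 => /=; rewrite !ler01 !lexx; split=> //.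
      by rewrite !mulr1 (_ : _ + _ = d%:R) ?ler1n // dR; ring.
    rewrite -bt in dtE t0 *.
    have -> : b / (d%:R * b) * (m3%:R + m1%:R * 1 + m2%:R * 1) ^+ 2 = d%:R.
      rewrite (_ : m3%:R + _ + _ = d%:R); last by rewrite dR; ring.
      by field; rewrite !gt_eqF.
    rewrite dR in dtE *; nra.
  have dt_ge1 : 1 <= d%:R * t.
    rewrite dtE; suff /m3_ge1 : m3%:R != 0 :> R by nra.
    apply/eqP => m3z; rewrite m3z in dtE dR.
    have : d%:R * t <= d%:R * b by rewrite dtE dR; nra.
    by rewrite ler_pM2l // leNgt bt.
  (* With a = 0 the general cut l = v / u used below is b, that is x = 0 and y = b. *)
  exists 0, b => /=; rewrite lexx ler01 (le_trans a0 ab) b1.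
  have SE : m3%:R + m1%:R * 0 + m2%:R * b = d%:R * t by rewrite dtE; ring.
  split=> //; first by rewrite SE.
  rewrite SE.
  have -> : b / (d%:R * t) * (d%:R * t) ^+ 2 = b * (d%:R * t).
    by field; rewrite !gt_eqF.
  by rewrite dtE; nra.
have a_gt0 : 0 < a by rewrite lt_neqAle eq_sym an0.
have b_lt1 : 0 < 1 - b by lra.
have a_lt1 : 0 < 1 - a by lra.
have m3z : m3%:R != 0 :> R.
  apply/eqP => m3z; rewrite m3z in dtE dR.
  have dm : 0 < m1%:R + m2%:R :> R by lra.
  have : (a + b) * (m1%:R + m2%:R) <= a * m1%:R + b * m2%:R.
    rewrite -[leRHS]addr0 -dtE dR addr0 mulrC ler_pM2l //.
  have : 0 < a * m2%:R + b * m1%:R.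
    have b0 : 0 < b by lra.
    have [m1z|m1p] := eqVneq (m1%:R : R) 0.
      by rewrite m1z mulr0 addr0 mulr_gt0 //; lra.
    by rewrite ltr_wpDl ?mulr_ge0 ?mulr_gt0 // lt_neqAle eq_sym m1p.
  lra.
have m31 := m3_ge1 m3z.
(* The normalised weights run from b to 1 along the first strip and from a to 1 along the second, so
   [A] and [B] count monomials per unit of weight. *)
pose A := m1%:R / (1 - b); pose B := m2%:R / (1 - a); pose c : R := m3%:R.
have m1E : m1%:R = A * (1 - b) by rewrite /A divfK // gt_eqF.
have m2E : m2%:R = B * (1 - a) by rewrite /B divfK // gt_eqF.
have A0 : 0 <= A by rewrite divr_ge0 // ltW.
have B0 : 0 <= B by rewrite divr_ge0 // ltW.
clearbody A B.
(* For a cut at weight l, S = u + (A + B) l and W = v + (A + B) l^2; the derivative of W / S^2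
   vanishes when l u = v. *)
pose u := c - A * b - B * a; pose v := c * (a + b) - A * b ^+ 2 - B * a ^+ 2.
have uv : u - v = d%:R * (t - a - b).
  by rewrite !mulrBr dtE dR m1E m2E /u /v -/c; ring.
have uv0 : v <= u by rewrite -subr_ge0 uv mulr_ge0 //; lra.
have vbu : b * u < v.
  rewrite -subr_gt0 (_ : v - b * u = c * a + B * a * (b - a)); last by rewrite /u /v; ring.
  have c0 : 0 < c by rewrite (lt_le_trans ltr01).
  by apply: ltr_pwDl; [exact: mulr_gt0|apply: mulr_ge0; [exact: mulr_ge0|lra]].
have u0 : 0 < u by nra.
pose l := v / u.
have lu : l * u = v by rewrite /l divfK // gt_eqF.
(* The third strip has normalised weights between a and b, below the cut, and is therefore kept
   whole. *)
have bl : b < l by rewrite -(ltr_pM2r u0) lu.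
have l1 : l <= 1 by rewrite -(ler_pM2r u0) lu mul1r.
pose x := (l - b) / (1 - b); pose y := (l - a) / (1 - a).
have x01 : 0 <= x <= 1.
  apply/andP; split; first by apply: divr_ge0; lra.
  by rewrite ler_pdivrMr // mul1r; lra.
have y01 : 0 <= y <= 1.
  apply/andP; split; first by apply: divr_ge0; lra.
  by rewrite ler_pdivrMr // mul1r; lra.
exists x, y => /=; split=> //.
  by rewrite -addrA ler_wpDr // addr_ge0 // mulr_ge0 //; [case/andP: x01|case/andP: y01].
have xE : (1 - b) * x = l - b by rewrite mulrC divfK // gt_eqF.
have yE : (1 - a) * y = l - a by rewrite mulrC divfK // gt_eqF.
clearbody x y.
set S := m3%:R + _ + _; set W := _ + m2%:R * (_ + _).
have dE' : d%:R = A * (1 - b) + B * (1 - a) + c by rewrite dR -m1E -m2E.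
pose q1 := c + A * (a - b); pose q2 := c + B * (b - a).
have dta : d%:R * (t - a) = (1 - a) * q2.
  by rewrite mulrBr dtE dE' m1E m2E -/c /q2; ring.
have dtb : d%:R * (t - b) = (1 - b) * q1.
  by rewrite mulrBr dtE dE' m1E m2E -/c /q1; ring.
have ta0 : 0 < t - a by lra.
have tb0 : 0 < t - b by lra.
have q20 : 0 < q2 by rewrite -(pmulr_rgt0 _ a_lt1) -dta mulr_gt0.
have q10 : 0 < q1 by rewrite -(pmulr_rgt0 _ b_lt1) -dtb mulr_gt0.
have Su : S * u = q1 * q2.
  have -> : S = u + (A + B) * l.
    rewrite /S m1E m2E -!mulrA xE yE /u -/c; ring.
  rewrite mulrDl -mulrA lu /u /v /q1 /q2; ring.
have Wu : W * u ^+ 2 = v * (q1 * q2).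
  have -> : W = v + (A + B) * l ^+ 2.
    have -> : W = c * (a + b) + A * (2 * b * ((1 - b) * x) + ((1 - b) * x) ^+ 2)
        + B * (2 * a * ((1 - a) * y) + ((1 - a) * y) ^+ 2).
      by rewrite /W m1E m2E -/c; ring.
    by rewrite xE yE /v; ring.
  rewrite mulrDl -mulrA -exprMn lu /u /v /q1 /q2; ring.
have -> : (a * b + (a + b - a * b) * (t - a - b)) / (d%:R * (t - a) * (t - b)) =
    v / (q1 * q2).
  have n1 : d%:R * (t - a) * (t - b) != 0 by apply/lt0r_neq0; rewrite !mulr_gt0.
  have n2 : q1 * q2 != 0 by apply/lt0r_neq0; rewrite mulr_gt0.
  apply/eqP; rewrite eqr_div //; apply/eqP; apply: (mulfI (lt0r_neq0 dR0)).
  have dnum : d%:R * (a * b + (a + b - a * b) * (t - a - b)) = v * ((1 - a) * (1 - b)).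
    rewrite mulrDr [d%:R * (_ * _)]mulrCA -[d%:R * ((_ - _) * _)]mulrCA -uv /u /v dE'.
    ring.
  rewrite mulrA dnum.
  transitivity (v * ((1 - a) * q2 * ((1 - b) * q1))); first by ring.
  by rewrite -dta -dtb; ring.
rewrite -(ler_pM2r (exprn_gt0 2 u0)) Wu -[leRHS]mulrA -exprMn Su expr2 [leRHS]mulrA divfK //.
by apply/lt0r_neq0; rewrite mulr_gt0.
Qed.

End Exponent.

(** * The interpolation monomials *)

Section MonomialSet.
Variable R : realType.

Definition mnm3 (x y z : nat) : 'X_{1..3} := [multinom nth 0%N [:: x; y; z] i | i < 3].

Lemma mnm3E x y z : [/\ mnm3 x y z 0 = x, mnm3 x y z 1 = y & mnm3 x y z 2 = z].
Proof. by rewrite /mnm3 !mnmE. Qed.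

Lemma ord3_big (T : Type) (idx : T) (op : T -> T -> T) (F : 'I_3 -> T) :
  \big[op/idx]_i F i = op (F 0) (op (F 1) (op (F 2) idx)).
Proof.
rewrite !big_ord_recl big_ord0.
have -> : lift ord0 (lift ord0 ord0) = 2 :> 'I_3 by apply: val_inj.
by have -> : lift ord0 ord0 = 1 :> 'I_3 by apply: val_inj.
Qed.

Lemma mdeg3 (m : 'X_{1..3}) : mdeg m = (m 0%R + (m 1%R + m 2%R))%N.
Proof. by rewrite mdegE ord3_big addn0. Qed.

Lemma mnm3_inj x y z x' y' z' : mnm3 x y z = mnm3 x' y' z' ->
  [/\ x = x', y = y' & z = z'].
Proof.
move=> E; have [e0 e1 e2] := mnm3E x y z; have [e0' e1' e2'] := mnm3E x' y' z'.
by split; [rewrite -e0 E e0'|rewrite -e1 E e1'|rewrite -e2 E e2'].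
Qed.

Definition weight (a b : R) (m : 'X_{1..3}) : R :=
  a * (m 0)%:R + b * (m 1)%:R + (m 2)%:R.


(* The strip number i consists of monomials of degree M + 2 d whose exponent of x_i is
   less than m_i. *)
Definition strip3 M d m3 : seq 'X_{1..3} :=
  [seq mnm3 (M + 2 * d - j - k) j k | k <- iota 0 m3, j <- iota 0 M].
Definition strip1 M d m1 m3 n : seq 'X_{1..3} :=
  [seq mnm3 i (M + 2 * d - i - (m3 + j)) (m3 + j) | i <- iota 0 m1, j <- iota 0 n].
Definition strip2 M d m2 m3 n : seq 'X_{1..3} :=
  [seq mnm3 (M + 2 * d - i - (m3 + j)) i (m3 + j) | i <- iota 0 m2, j <- iota 0 n].

Lemma sum_iota_le (f : nat -> R) (A B C : R) n : 0 <= B ->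
  (forall j, (j < n)%N -> f j <= A + B * j%:R + C) ->
  \sum_(j <- iota 0 n) f j <= n%:R * A + B * n%:R ^+ 2 / 2 + C * n%:R.
Proof.
move=> B0 fP; apply: le_trans (_ : \sum_(j <- iota 0 n) (A + B * j%:R + C) <= _).
  rewrite big_seq [leRHS]big_seq; apply: ler_sum => j; rewrite mem_iota => /fP; exact.
elim: n {fP} => [|n IH]; first by rewrite big_nil; lra.
rewrite -addn1 iotaD big_cat big_seq1 /= add0n natrD.
apply: le_trans (lerD IH (lexx _)) _; nra.
Qed.

Lemma sum_strip_le (f : nat -> nat -> 'X_{1..3}) (a b A B C : R) m n : 0 <= B ->
  (forall i j, (i < m)%N -> (j < n)%N -> weight a b (f i j) <= A + B * j%:R + C) ->
  \sum_(e <- [seq f i j | i <- iota 0 m, j <- iota 0 n]) weight a b e <=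
    m%:R * (n%:R * A + B * n%:R ^+ 2 / 2 + C * n%:R).
Proof.
move=> B0 fP; rewrite big_allpairs_dep /=.
apply: le_trans (sum_iota_le (A := n%:R * A + B * n%:R ^+ 2 / 2 + C * n%:R) (B := 0)
  (C := 0) (lexx 0) _) _.
  by move=> i im; rewrite mul0r !addr0; apply: sum_iota_le => // j; apply: fP.
by rewrite !mul0r !addr0.
Qed.


Section Strips.
Variables M d m1 m2 m3 n1 n2 : nat.
Hypotheses (dE : d = (m1 + m2 + m3)%N) (n1M : (n1 <= M)%N) (n2M : (n2 <= M)%N).

Definition strips := strip3 M d m3 ++ strip1 M d m1 m3 n1 ++ strip2 M d m2 m3 n2.

Lemma size_strips : size strips = (m3 * M + m1 * n1 + m2 * n2)%N.
Proof. by rewrite !size_cat !size_allpairs !size_iota addnA. Qed.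

Lemma strip3P e : e \in strip3 M d m3 -> exists j k, [/\ (k < m3)%N, (j < M)%N &
    e = mnm3 (M + 2 * d - j - k) j k].
Proof.
by move=> /allpairsP[[k j] /= []]; rewrite !mem_iota !add0n /= => kP jP ->; exists j, k.
Qed.

Lemma strip1P e : e \in strip1 M d m1 m3 n1 -> exists i j, [/\ (i < m1)%N, (j < n1)%N &
    e = mnm3 i (M + 2 * d - i - (m3 + j)) (m3 + j)].
Proof.
by move=> /allpairsP[[i j] /= []]; rewrite !mem_iota !add0n /= => iP jP ->; exists i, j.
Qed.

Lemma strip2P e : e \in strip2 M d m2 m3 n2 -> exists i j, [/\ (i < m2)%N, (j < n2)%N &
    e = mnm3 (M + 2 * d - i - (m3 + j)) i (m3 + j)].
Proof.
by move=> /allpairsP[[i j] /= []]; rewrite !mem_iota !add0n /= => iP jP ->; exists i, j.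
Qed.

(** The exponent of x_3 separates the third strip from the others. The first two are disjoint
    because the degree exceeds M by 2 d, a margin that also keeps the truncated subtractions
    exact. *)
Lemma uniq_strips : uniq strips.
Proof.
rewrite !cat_uniq; apply/and3P; split.
+ apply: allpairs_uniq; rewrite ?iota_uniq // => -[k j] [k' j'] _ _ /= /mnm3_inj[_ -> ->].
  by [].
+ apply/hasPn => e; rewrite mem_cat => He; apply/negP => /strip3P[j [k [km _ eE]]].
  have [_ _ e2] := mnm3E (M + 2 * d - j - k) j k; rewrite -eE in e2.
  case/orP: He => [/strip1P|/strip2P] [i [j' [_ _ eE']]].
    have [_ _] := mnm3E i (M + 2 * d - i - (m3 + j')) (m3 + j').
    by rewrite -eE' e2; lia.
  have [_ _] := mnm3E (M + 2 * d - i - (m3 + j')) i (m3 + j').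
  by rewrite -eE' e2; lia.
+ apply/and3P; split.
  * apply: allpairs_uniq; rewrite ?iota_uniq // => -[i j] [i' j'] _ _ /= /mnm3_inj[-> _].
    by move/addnI ->.
  * apply/hasPn => e /strip2P[i [j [im jn eE]]]; apply/negP => /strip1P[i' [j' [im' jn' eE']]].
    have [] := mnm3E i' (M + 2 * d - i' - (m3 + j')) (m3 + j'); rewrite -eE' eE.
    have [-> _ _] := mnm3E (M + 2 * d - i - (m3 + j)) i (m3 + j).
    by lia.
  * apply: allpairs_uniq; rewrite ?iota_uniq // => -[i j] [i' j'] _ _ /= /mnm3_inj[_ -> ].
    by move/addnI ->.
Qed.

Lemma strips_mem (m e : 'X_{1..3}) : m1 = m 0 -> m2 = m 1 -> m3 = m 2 -> e \in strips ->
  mdeg e = (M + 2 * d)%N /\ ~~ (m <= e)%MM.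
Proof.
move=> m1E m2E m3E; rewrite !mem_cat => /or3P[/strip3P|/strip1P|/strip2P].
+ move=> [j [k [km jM ->]]]; have [e0 e1 e2] := mnm3E (M + 2 * d - j - k) j k.
  split; first by rewrite mdeg3 e0 e1 e2; lia.
  by apply/negP => /mnm_lepP/(_ 2); rewrite e2 -m3E; lia.
+ move=> [i [j [im jn ->]]]; have [e0 e1 e2] := mnm3E i (M + 2 * d - i - (m3 + j)) (m3 + j).
  split; first by rewrite mdeg3 e0 e1 e2; lia.
  by apply/negP => /mnm_lepP/(_ 0); rewrite e0 -m1E; lia.
+ move=> [i [j [im jn ->]]]; have [e0 e1 e2] := mnm3E (M + 2 * d - i - (m3 + j)) i (m3 + j).
  split; first by rewrite mdeg3 e0 e1 e2; lia.
  by apply/negP => /mnm_lepP/(_ 1); rewrite e1 -m2E; lia.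
Qed.


Variables a b x y : R.
Hypotheses (a0 : 0 <= a) (ab : a <= b) (b1 : b <= 1).
Hypotheses (x01 : 0 <= x <= 1) (y01 : 0 <= y <= 1).

Lemma sum_iota_quad_le (z c : R) n : n%:R <= z * M%:R -> (n <= M)%N -> 0 <= z <= 1 ->
  0 <= c <= 1 ->
  n%:R * (c * M%:R) + (1 - c) * n%:R ^+ 2 / 2 + (4 * d%:R) * n%:R <=
    M%:R ^+ 2 * ((2 * c * z + (1 - c) * z ^+ 2) / 2) + 4 * d%:R * M%:R.
Proof.
move=> nz nM /andP[z0 _] /andP[c0 c1]; rewrite -(ler_nat R) in nM.
have t1 : n%:R * (c * M%:R) <= (z * M%:R) * (c * M%:R).
  by rewrite ler_wpM2r // mulr_ge0.
have t2 : (1 - c) * n%:R ^+ 2 <= (1 - c) * (z * M%:R) ^+ 2.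
  by rewrite ler_wpM2l ?subr_ge0 // lerXn2r // nnegrE // mulr_ge0.
have t3 : (4 * d%:R) * n%:R <= (4 * d%:R) * M%:R :> R by rewrite ler_wpM2l // mulr_ge0.
have -> : M%:R ^+ 2 * ((2 * c * z + (1 - c) * z ^+ 2) / 2) =
  (z * M%:R) * (c * M%:R) + ((1 - c) * (z * M%:R) ^+ 2) / 2 by field.
lra.
Qed.

Lemma strip3_weight : \sum_(e <- strip3 M d m3) weight a b e <=
  m3%:R * (M%:R * (a * M%:R) + (b - a) * M%:R ^+ 2 / 2 + (4 * d%:R) * M%:R).
Proof.
apply: sum_strip_le => [|k j km jM]; first by rewrite subr_ge0.
have [e0 e1 e2] := mnm3E (M + 2 * d - j - k) j k.
have le1 : (j <= M + 2 * d)%N by lia.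
have le2 : (k <= M + 2 * d - j)%N by lia.
have kd : k%:R <= d%:R :> R by rewrite ler_nat; lia.
rewrite /weight e0 e1 e2 !natrB // natrD natrM.
have : a * d%:R <= 1 * d%:R by rewrite ler_wpM2r // (le_trans ab).
have : 0 <= a * k%:R by rewrite mulr_ge0.
by rewrite mul1r; nra.
Qed.

Lemma strip1_weight : \sum_(e <- strip1 M d m1 m3 n1) weight a b e <=
  m1%:R * (n1%:R * (b * M%:R) + (1 - b) * n1%:R ^+ 2 / 2 + (4 * d%:R) * n1%:R).
Proof.
apply: sum_strip_le => [|i j im jn]; first by rewrite subr_ge0.
have [e0 e1 e2] := mnm3E i (M + 2 * d - i - (m3 + j)) (m3 + j).
have le1 : (i <= M + 2 * d)%N by lia.
have le2 : (m3 + j <= M + 2 * d - i)%N by lia.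
have id : i%:R + m3%:R <= d%:R :> R by rewrite -natrD ler_nat; lia.
rewrite /weight e0 e1 e2 !natrB // (natrD _ M) natrM (natrD _ m3).
have b0 := le_trans a0 ab.
have : a * i%:R <= 1 * i%:R by rewrite ler_wpM2r // (le_trans ab).
have : b * d%:R <= 1 * d%:R by rewrite ler_wpM2r.
have : 0 <= b * i%:R by rewrite mulr_ge0.
have : 0 <= b * m3%:R by rewrite mulr_ge0.
by rewrite !mul1r; nra.
Qed.

Lemma strip2_weight : \sum_(e <- strip2 M d m2 m3 n2) weight a b e <=
  m2%:R * (n2%:R * (a * M%:R) + (1 - a) * n2%:R ^+ 2 / 2 + (4 * d%:R) * n2%:R).
Proof.
have a1 := le_trans ab b1.
apply: sum_strip_le => [|i j im jn]; first by rewrite subr_ge0.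
have [e0 e1 e2] := mnm3E (M + 2 * d - i - (m3 + j)) i (m3 + j).
have le1 : (i <= M + 2 * d)%N by lia.
have le2 : (m3 + j <= M + 2 * d - i)%N by lia.
have id : i%:R + m3%:R <= d%:R :> R by rewrite -natrD ler_nat; lia.
rewrite /weight e0 e1 e2 !natrB // (natrD _ M) natrM (natrD _ m3).
have : b * i%:R <= 1 * i%:R by rewrite ler_wpM2r.
have : a * d%:R <= 1 * d%:R by rewrite ler_wpM2r.
have : 0 <= a * i%:R by rewrite mulr_ge0.
have : 0 <= a * m3%:R by rewrite mulr_ge0.
by rewrite !mul1r; nra.
Qed.

(** Each weight exceeds its linear model along the strip by at most 4 d, and there are at most d M
    monomials, whence the error term. *)
Lemma strips_weight_le : n1%:R <= x * M%:R -> n2%:R <= y * M%:R ->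
  \sum_(e <- strips) weight a b e <=
  M%:R ^+ 2 * ((m3%:R * (a + b) + m1%:R * (2 * b * x + (1 - b) * x ^+ 2)
     + m2%:R * (2 * a * y + (1 - a) * y ^+ 2)) / 2) + 4 * d%:R ^+ 2 * M%:R.
Proof.
move=> n1x n2y.
have b01 : 0 <= b <= 1 by rewrite (le_trans a0) ?b1.
have a01 : 0 <= a <= 1 by rewrite a0 (le_trans ab).
have v1 := le_trans strip1_weight
  (ler_wpM2l (ler0n _ m1) (sum_iota_quad_le n1x n1M x01 b01)).
have v2 := le_trans strip2_weight
  (ler_wpM2l (ler0n _ m2) (sum_iota_quad_le n2y n2M y01 a01)).
rewrite !big_cat /=; apply: le_trans (lerD strip3_weight (lerD v1 v2)) _.
by rewrite le_eqVlt; apply/orP; left; apply/eqP; rewrite dE !natrD; field.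
Qed.

Lemma size_strips_ge : x * M%:R <= n1%:R + 1 -> y * M%:R <= n2%:R + 1 ->
  M%:R * (m3%:R + m1%:R * x + m2%:R * y) - d%:R <= (size strips)%:R.
Proof.
move=> n1x n2y; rewrite size_strips dE !natrD !natrM.
have h1 : m1%:R * (x * M%:R) <= m1%:R * (n1%:R + 1) by rewrite ler_wpM2l.
have h2 : m2%:R * (y * M%:R) <= m2%:R * (n2%:R + 1) by rewrite ler_wpM2l.
have : 0 <= m3%:R :> R by [].
have -> : M%:R * (m3%:R + m1%:R * x + m2%:R * y) =
  m3%:R * M%:R + m1%:R * (x * M%:R) + m2%:R * (y * M%:R) by ring.
by move: h1 h2; rewrite !mulrDr !mulr1; lra.
Qed.

End Strips.

(** The ratio tends to W / S^2 as M grows. In 14 d^3, the part 6 d^3 pays for replacing s (s - 1) by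
    M^2 S^2 and 8 d^3 for the error in the weights. The proof works with r = W / S^2, which unlike T
    is bounded, by 2 d. *)
Lemma interpolation_ratio (d M eps W S s T : R) : 1 <= d -> 0 < eps -> d + 2 <= M ->
  3 * d ^+ 2 + 14 * d ^+ 3 / eps <= M -> 0 <= W -> W <= 2 * d -> 1 <= S -> S <= d ->
  W <= T * S ^+ 2 -> M * S - d <= s ->
  M ^+ 2 * (W / 2) + 4 * d ^+ 2 * M <= (T + eps) * (s * (s - 1) / 2).
Proof.
move=> d1 eps0 Md Meps W0 W2d S1 Sd WS sge.
have d0 : 0 <= d by lra.
have M0 : 0 <= M by lra.
have MS : M <= M * S by rewrite ler_peMr.
have S20 : 0 < S ^+ 2 by rewrite exprn_gt0 // (lt_le_trans ltr01).
pose r := W / S ^+ 2.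
have rS : r * S ^+ 2 = W by rewrite /r divfK // gt_eqF.
have r_le : r <= T by rewrite ler_pdivrMr.
have r0 : 0 <= r by rewrite divr_ge0 // ltW.
have r2d : r <= 2 * d.
  apply: le_trans W2d; rewrite ler_pdivrMr // ler_peMr //; exact: exprn_ege1.
clearbody r; apply: le_trans (_ : (r + eps) * (s * (s - 1) / 2) <= _); last first.
  by rewrite ler_wpM2r ?lerD2r // divr_ge0 // mulr_ge0 //; lra.
have X2 : M ^+ 2 * S ^+ 2 - 3 * d ^+ 2 * M <= s * (s - 1).
  have dX : 0 <= d * (d * M - M * S).
    by rewrite mulr_ge0 // subr_ge0 mulrC ler_wpM2r.
  have dX' : 1 * (M * S) <= d * (M * S) by rewrite ler_wpM2r // (le_trans M0).
  have d20 : 0 <= d ^+ 2 by rewrite exprn_ge0.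
  have : (M * S - d) * (M * S - d - 1) <= s * (s - 1) by apply: ler_pM; lra.
  apply: le_trans; rewrite -subr_ge0.
  have -> : (M * S - d) * (M * S - d - 1) - (M ^+ 2 * S ^+ 2 - 3 * d ^+ 2 * M) =
    3 * (d * (d * M - M * S)) + (d * (M * S) - 1 * (M * S)) + d ^+ 2 + d by ring.
  lra.
have e1 : (r + eps) * (M ^+ 2 * S ^+ 2 - 3 * d ^+ 2 * M) <= (r + eps) * (s * (s - 1)).
  by rewrite ler_wpM2l // addr_ge0 // ltW.
have e2 : (r + eps) * (M ^+ 2 * S ^+ 2 - 3 * d ^+ 2 * M) =
    M ^+ 2 * W - 3 * d ^+ 2 * M * r
      + eps * (M ^+ 2 * S ^+ 2 - 3 * d ^+ 2 * M) by rewrite -rS; ring.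
have e3 : 3 * d ^+ 2 * M * r <= 3 * d ^+ 2 * M * (2 * d).
  by rewrite ler_wpM2l // !mulr_ge0 // exprn_ge0.
have e4 : eps * (M ^+ 2 - 3 * d ^+ 2 * M) <=
    eps * (M ^+ 2 * S ^+ 2 - 3 * d ^+ 2 * M).
  by rewrite (ler_wpM2l (ltW eps0)) // lerD2r ler_peMr ?exprn_ge0 // exprn_ege1.
have e5 : 14 * d ^+ 3 * M <= eps * (M ^+ 2 - 3 * d ^+ 2 * M).
  have -> : eps * (M ^+ 2 - 3 * d ^+ 2 * M) = eps * (M - 3 * d ^+ 2) * M.
    by ring.
  by rewrite ler_wpM2r // [eps * _]mulrC -ler_pdivrMr //; lra.
have e6 : d ^+ 2 * M <= d ^+ 3 * M.
  by rewrite ler_wpM2r // [d ^+ 3]exprS ler_peMl // exprn_ge0.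
have d3 : 3 * d ^+ 2 * M * (2 * d) = 6 * (d ^+ 3 * M) by ring.
have w2 : M ^+ 2 * (W / 2) = (M ^+ 2 * W) / 2 by rewrite mulrA.
lra.
Qed.

Lemma bin2_natr (s : nat) : (0 < s)%N -> 'C(s, 2)%:R = s%:R * (s%:R - 1) / 2 :> R.
Proof.
move=> s0; have : ('C(s, 2) * 2 = s * s.-1)%N.
  by rewrite -[2%N in LHS]/(2`!)%N bin_ffact ffactnS ffactn1.
move/(congr1 (fun k => k%:R : R)); rewrite !natrM -subn1 natrB // => <-.
by rewrite mulfK // pnatr_eq0.
Qed.

(** The order of quantifiers matters: one degree [D] serves all boxes and all dominant monomials. *)
Lemma monomial_set (d : nat) (eps : R) : (0 < d)%N -> 0 < eps ->
  exists D : nat, forall (a b t : R) (m : 'X_{1..3}),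
    mdeg m = d -> 0 <= a -> a <= b -> b <= 1 -> a + b <= t -> 0 < t ->
    d%:R * t = weight a b m ->
    exists E : seq 'X_{1..3}, [/\ uniq E, (1 < size E)%N,
      forall e, e \in E -> mdeg e = D /\ ~~ (m <= e)%MM &
      \sum_(e <- E) weight a b e <= (exponent d a b t + eps) * 'C(size E, 2)%:R].
Proof.
move=> d0 eps0.
have dR1 : 1 <= d%:R :> R by rewrite ler1n.
have [M Md Meps] : exists2 M : nat, (d + 2 <= M)%N &
    3 * d%:R ^+ 2 + 14 * d%:R ^+ 3 / eps <= M%:R.
  exists (3 * (d * d) + d + 2 + (Num.truncn (14 * d%:R ^+ 3 / eps)).+1)%N; first by lia.
  have := truncnS_gt (14 * d%:R ^+ 3 / eps); move: (Num.truncn _) => n.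
  by rewrite !natrD !natrM expr2; have : 0 <= d%:R :> R by []; lra.
exists (M + 2 * d)%N => a b t m md a0 ab b1 abt t0 dtE.
have [m1 m1E] : exists m1, m1 = m 0 by exists (m 0).
have [m2 m2E] : exists m2, m2 = m 1 by exists (m 1).
have [m3 m3E] : exists m3, m3 = m 2 by exists (m 2).
rewrite /weight -m1E -m2E -m3E in dtE.
have dE : d = (m1 + m2 + m3)%N by rewrite -md mdeg3 addnA m1E m2E m3E.
have [x [y /= [x01 y01 S1 WS]]] := exponent_attained d0 dE a0 ab b1 abt t0 dtE.
have trunc_bound (z : R) : 0 <= z <= 1 -> exists2 n, (n <= M)%N &
    n%:R <= z * M%:R <= n%:R + 1.
  move=> /andP[z0 z1]; have zM0 : 0 <= z * M%:R by rewrite mulr_ge0.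
  have := truncn_itv zM0; rewrite -natr1 => /andP[le lt].
  exists (Num.truncn (z * M%:R)); last by rewrite le ltW.
  by rewrite -(ler_nat R); apply: le_trans le _; rewrite ler_piMl.
have [n1 n1M /andP[n1x xn1]] := trunc_bound x x01.
have [n2 n2M /andP[n2y yn2]] := trunc_bound y y01.
have sge := size_strips_ge dE xn1 yn2.
have wle := strips_weight_le dE n1M n2M a0 ab b1 x01 y01 n1x n2y.
have [x0 x1] := andP x01; have [y0 y1] := andP y01.
have dR : d%:R = m1%:R + m2%:R + m3%:R :> R by rewrite dE !natrD.
have h1 : m1%:R * x <= m1%:R * 1 by rewrite ler_wpM2l.
have h2 : m2%:R * y <= m2%:R * 1 by rewrite ler_wpM2l.
set S := m3%:R + _ + _ in S1 WS sge; set W := _ + _ + _ in WS wle.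
have Sd : S <= d%:R by rewrite /S dR; lra.
have MdR : d%:R + 2 <= M%:R :> R by rewrite -natrD ler_nat.
have MS : M%:R <= M%:R * S by rewrite ler_peMr.
have s1 : (1 < size (strips M d m1 m2 m3 n1 n2))%N by rewrite -(ltr_nat R); lra.
exists (strips M d m1 m2 m3 n1 n2); split=> //.
- exact: uniq_strips.
- by move=> e; apply: strips_mem.
apply: le_trans wle _; rewrite bin2_natr ?(ltnW s1) //.
apply: interpolation_ratio (sge) => //.
- by rewrite /W !addr_ge0 // !mulr_ge0 // ?addr_ge0 ?mulr_ge0 ?subr_ge0 ?exprn_ge0 //
    ?(le_trans a0) // (le_trans ab).
have wb (z c : R) : 0 <= z -> z <= 1 -> 0 <= c <= 1 ->
    2 * c * z + (1 - c) * z ^+ 2 <= 2.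
  move=> z0 z1 /andP[c0 c1].
  have : (1 - c) * z ^+ 2 <= (1 - c) * 1 by rewrite ler_wpM2l ?subr_ge0 ?exprn_ile1.
  have : c * z <= c * 1 by rewrite ler_wpM2l.
  lra.
have q1 := wb x b x0 x1 (introT andP (conj (le_trans a0 ab) b1)).
have q2 := wb y a y0 y1 (introT andP (conj a0 (le_trans ab b1))).
have r1 := ler_wpM2l (ler0n R m1) q1; have r2 := ler_wpM2l (ler0n R m2) q2.
have : m3%:R * (a + b) <= m3%:R * 2 by rewrite ler_wpM2l //; lra.
by rewrite /W dR; lra.
Qed.
End MonomialSet.

(** * Interpolating forms *)

Lemma seq_maximum (T : eqType) (le : rel T) (s : seq T) : reflexive le -> transitive le ->
  total le -> s != [::] -> exists2 x, x \in s & {in s, forall y, le y x}.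
Proof.
move=> lexx le_tr le_tot; elim: s => // x [|y s] IH _.
  by exists x; rewrite ?mem_head // => z; rewrite inE => /eqP ->.
have [//|z zs zmax] := IH; case/orP: (le_tot x z) => [xz|zx].
  by exists z; [rewrite in_cons zs orbT|move=> w; rewrite in_cons => /orP[/eqP->|/zmax]].
exists x; first exact: mem_head.
move=> w; rewrite in_cons => /orP[/eqP->|/zmax wz]; first exact: lexx.
exact: le_tr zx.
Qed.

Section TopMonomial.
Variables (R : realType) (a b : R).

Lemma weightD (m m' : 'X_{1..3}) : weight a b (m + m')%MM = weight a b m + weight a b m'.
Proof. by rewrite /weight !mnmDE !natrD; ring. Qed.

(** Several monomials may share the largest weight; breaking ties by the monomial order gives a
    total order compatible with products, so that a polynomial has a single top monomial. *)
Definition weight_le (m m' : 'X_{1..3}) :=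
  (weight a b m < weight a b m') || ((weight a b m == weight a b m') && (m <= m')%O).

Lemma weight_le_refl : reflexive weight_le.
Proof. by move=> m; rewrite /weight_le eqxx lexx orbT. Qed.

Lemma weight_le_total : total weight_le.
Proof.
move=> m m'; rewrite /weight_le.
by case: (ltgtP (weight a b m) (weight a b m')) => //= _; exact: le_total.
Qed.

Lemma weight_le_trans : transitive weight_le.
Proof.
move=> m2 m1 m3; rewrite /weight_le => /orP[l12|/andP[/eqP e12 o12]];
  case/orP => [l23|/andP[/eqP e23 o23]].
- by rewrite (lt_trans l12 l23).
- by rewrite -e23 l12.
- by rewrite e12 l23.
- by rewrite e12 e23 eqxx (le_trans o12 o23) orbT.
Qed.

Lemma weight_le_add_eq (m1 m2 n1 n2 : 'X_{1..3}) : weight_le m1 n1 -> weight_le m2 n2 ->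
  (m1 + m2 = n1 + n2)%MM -> m1 = n1 /\ m2 = n2.
Proof.
move=> le1 le2 E; have := congr1 (weight a b) E; rewrite !weightD => wE.
have [w1 w2] : weight a b m1 <= weight a b n1 /\ weight a b m2 <= weight a b n2.
  by split; [case/orP: le1 => [/ltW|/andP[/eqP->]]|case/orP: le2 => [/ltW|/andP[/eqP->]]].
have o1 : (m1 <= n1)%O by case/orP: le1 => [lt|/andP[]//]; exfalso; clear E; lra.
have o2 : (m2 <= n2)%O by case/orP: le2 => [lt|/andP[]//]; exfalso; clear E; lra.
have m1E : m1 = n1.
  apply/eqP; move: o1; rewrite le_eqVlt => /orP[//|lt1].
  by have := ltmc_le_add lt1 o2; rewrite E ltxx.
by split=> //; move: E; rewrite m1E => /addmI.
Qed.

(** The top monomials of [F] and of the quotient multiply to a monomial of [g] that arises in no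
    other way, hence does not cancel. *)
Lemma divides_top_monomial (A : idomainType) (F g : {mpoly A[3]}) (m0 : 'X_{1..3}) :
  m0 \in msupp F -> {in msupp F, forall m, weight_le m m0} -> g != 0 ->
  divides F g -> exists2 e, e \in msupp g & (m0 <= e)%MM.
Proof.
move=> m0F m0max g0 [h gE].
have h0 : msupp h != [::] by rewrite msupp_eq0; apply: contraNneq g0 => h0; rewrite gE h0 mulr0.
have [m1 m1h m1max] := seq_maximum weight_le_refl weight_le_trans weight_le_total h0.
exists (m0 + m1)%MM; last exact: lem_addr.
rewrite mcoeff_msupp gE mcoeffM.
have lt0 : (mdeg m0 < (mdeg (m0 + m1)).+1)%N by rewrite mdegD ltnS leq_addr.
have lt1 : (mdeg m1 < (mdeg (m0 + m1)).+1)%N by rewrite mdegD ltnS leq_addl.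
rewrite (bigD1 (BMultinom lt0, BMultinom lt1)) //= big1 ?addr0.
  by rewrite mulf_neq0 // -mcoeff_msupp.
case=> k1 k2 /= /andP[/eqP kE kne]; apply/eqP; rewrite mulf_eq0 !mcoeff_eq0 -negb_and.
apply/negP => /andP[k1F k2h].
have [e1 e2] := weight_le_add_eq (m0max _ k1F) (m1max _ k2h) (esym kE).
move/negP: kne; apply; apply/eqP; congr pair; exact: val_inj.
Qed.
End TopMonomial.

Definition monomials (d : nat) : seq 'X_{1..3} :=
  map val (enum [pred m : 'X_{1..3 < d.+1} | mdeg m == d]).

Lemma mem_monomials d m : (m \in monomials d) = (mdeg m == d).
Proof.
apply/mapP/idP => [[k]|/eqP md]; first by rewrite mem_enum => kd ->.
have lt : (mdeg m < d.+1)%N by rewrite md.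
by exists (BMultinom lt) => //; rewrite mem_enum inE /= md.
Qed.

Lemma uniq_monomials d : uniq (monomials d).
Proof. by rewrite map_inj_uniq ?enum_uniq //; apply: val_inj. Qed.

Definition form_of_coeffs (E : seq 'X_{1..3}) (w : 'I_(size E) -> int) : {mpoly int[3]} :=
  \sum_j w j *: 'X_[nth 0%MM E j].
Arguments form_of_coeffs : clear implicits.

Lemma mcoeff_form_of_coeffs E w (j : 'I_(size E)) : uniq E -> (form_of_coeffs E w)@_(nth 0%MM E j) = w j.
Proof.
move=> uE; rewrite raddf_sum (bigD1 j) //= mcoeffZ mcoeffX eqxx mulr1 big1 ?addr0 // => i ij.
by rewrite mcoeffZ mcoeffX nth_uniq // val_eqE (negbTE ij) mulr0.
Qed.

Lemma msupp_form_of_coeffs E w e : e \in msupp (form_of_coeffs E w) -> e \in E.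
Proof.
rewrite mcoeff_msupp; apply: contraNT => eE; rewrite raddf_sum big1 // => j _ /=.
rewrite mcoeffZ mcoeffX; case: eqP => [E'|]; last by rewrite mulr0.
by rewrite -E' mem_nth in eE.
Qed.

Lemma meval_form_of_coeffs E w (v : 'I_3 -> int) :
  (form_of_coeffs E w).@[v] = \sum_(j < size E) (\prod_l v l ^+ (nth 0%MM E j) l) * w j.
Proof.
by rewrite raddf_sum; apply: eq_bigr => j _ /=; rewrite mevalZ mevalX mulrC.
Qed.

Definition eval_matrix N (x : 'I_N -> 'I_3 -> int) (E : seq 'X_{1..3}) :=
  \matrix_(a < N, e < size E) \prod_l x a l ^+ (nth 0%MM E e) l.

Lemma det_eq0_kernel n (B : 'M[int]_n) (v : 'cV[int]_n) : B *m v = 0 -> v != 0 -> \det B = 0.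
Proof.
move=> Bv; apply: contraNeq => detB.
have : \adj B *m (B *m v) = 0 by rewrite Bv mulmx0.
rewrite mulmxA mul_adj_mx mul_scalar_mx => /eqP.
by rewrite scalemx_eq0 (negbTE detB).
Qed.

(** Serves twice: with all monomials of degree d, where the bound on the coefficients matters, and
    with the interpolation monomials, where the support does. *)
Lemma interpolating_form (E : seq 'X_{1..3}) (s : seq 'rV[int]_3) (H : int) D :
  uniq E -> {in E, forall e, mdeg e = D} ->
  (forall f : 'I_(size E) -> 'I_(size s),
    \det (eval_matrix (fun a l => nth 0 s (f a) 0 l) E) = 0) ->
  1 <= H -> (forall x l, x \in s -> `|x 0 l| <= H) ->
  exists G : {mpoly int[3]}, [/\ G != 0, G \is D.-homog,
    {subset msupp G <= E}, {in s, forall x : 'rV_3, G.@[x 0] = 0} &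
    forall m, `|G@_m| <= (size E)`!%:Z * (H ^+ D) ^+ size E].
Proof.
move=> uE ED det0 H1 sH.
pose A := eval_matrix (fun (a : 'I_(size s)) l => nth 0 s a 0 l) E.
have HD1 : 1 <= H ^+ D by apply: exprn_ege1.
have H0 : 0 <= H by apply: le_trans H1.
have [|//|a e|w [[j wj] wA wle]] := @minor_kernel _ _ A (H ^+ D).
- move=> f; rewrite -(det0 f); congr (\det _).
  by apply/matrixP => a e; rewrite !mxE.
- rewrite mxE normr_prod -(ED (nth 0%MM E e)) ?mem_nth // mdegE -prodrXr.
  apply: ler_prod => l _; rewrite normrX exprn_ge0 //=.
  by rewrite lerXn2r ?nnegrE // sH // mem_nth.
exists (form_of_coeffs E w); split.
- by apply: contraNneq wj => G0; rewrite -(mcoeff_form_of_coeffs w j uE) G0 mcoeff0.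
- by apply/dhomogP => m /msupp_form_of_coeffs /ED.
- by move=> m /msupp_form_of_coeffs.
- move=> x xs; rewrite meval_form_of_coeffs.
  have xi : (index x s < size s)%N by rewrite index_mem.
  rewrite -[RHS](wA (Ordinal xi)); apply: eq_bigr => e _.
  by rewrite mxE /= nth_index.
- move=> m; have [/msupp_form_of_coeffs mE|] := boolP (m \in msupp (form_of_coeffs E w)).
    have mi : (index m E < size E)%N by rewrite index_mem.
    rewrite (_ : m = nth 0%MM E (Ordinal mi)); last by rewrite /= nth_index.
    by rewrite mcoeff_form_of_coeffs.
  rewrite -mcoeff_eq0 => /eqP ->.
  by rewrite normr0 mulr_ge0 // exprn_ge0 // exprn_ge0.
Qed.

(** * An equivalent form with small coefficients *)

Local Notation toC := (map_mpoly (intr : int -> algC)).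

Lemma mem_msupp_toC n (F : {mpoly int[n]}) m : (m \in msupp (toC F)) = (m \in msupp F).
Proof. by rewrite !mcoeff_msupp mcoeff_map_mpoly intr_eq0. Qed.

Lemma toC_eq0 n (F : {mpoly int[n]}) : (toC F == 0) = (F == 0).
Proof.
apply/eqP/eqP => [F0|->]; last by rewrite rmorph0.
apply/mpolyP => m; apply/eqP; have := congr1 (mcoeff m) F0.
by rewrite mcoeff_map_mpoly !mcoeff0 => /eqP; rewrite intr_eq0.
Qed.

Lemma prime_elt_mul_unit (A : idomainType) (p u : A) : prime_elt p ->
  u \is a GRing.unit -> prime_elt (p * u).
Proof.
move=> [p0 pU pP] uU; split.
- by rewrite mulf_neq0 //; apply: contraTneq uU => ->; rewrite unitr0.
- by rewrite unitrM negb_and pU.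
move=> a b [c E]; have [] := pP a b; first by exists (u * c); rewrite E mulrA.
- by case=> e ->; left; exists (u^-1 * e); rewrite -mulrA mulVKr.
- by case=> e ->; right; exists (u^-1 * e); rewrite -mulrA mulVKr.
Qed.

Lemma msize_dhomog (A : nzRingType) n d (F : {mpoly A[n]}) : F \is d.-homog -> F != 0 ->
  msize F = d.+1.
Proof. by move=> /dhomogP Fd F0; rewrite -mlead_deg // Fd // mlead_supp. Qed.

Lemma dhomog_coeffs d (F : {mpoly int[3]}) : F \is d.-homog ->
  form_of_coeffs (monomials d) (fun j => F@_(nth 0%MM (monomials d) j)) = F.
Proof.
move=> Fd; apply/mpolyP => m; have [md|md] := boolP (m \in monomials d).
  have mi : (index m (monomials d) < size (monomials d))%N by rewrite index_mem.
  have -> : m = nth 0%MM (monomials d) (Ordinal mi) by rewrite /= nth_index.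
  by rewrite mcoeff_form_of_coeffs // uniq_monomials.
rewrite !memN_msupp_eq0 //.
- by apply: contraNN md => mF; rewrite mem_monomials; apply/eqP/(dhomog_mf Fd).
- by apply: contraNN md => /msupp_form_of_coeffs.
Qed.

(** The coefficient vector of [F] is killed by every square evaluation matrix, so the determinants
    vanish and [interpolating_form] yields [G]. The points exceed Bezout's bound, so [F] divides
    [G]; the degrees being equal, the quotient is a non-zero constant. *)
Lemma small_proportional_form (F : {mpoly int[3]}) d (s : seq 'rV[int]_3) (H : int) :
  F \is d.-homog -> prime_elt (toC F) -> uniq s -> 1 <= H ->
  (forall x, x \in s -> [/\ primitive x, F.@[x 0] = 0 & forall l, `|x 0 l| <= H]) ->
  (2 * (d * d) < size s)%N ->
  exists G : {mpoly int[3]}, [/\ G \is d.-homog, prime_elt (toC G),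
    {in s, forall x : 'rV_3, G.@[x 0] = 0} &
    forall m, `|G@_m| <= (size (monomials d))`!%:Z * (H ^+ d) ^+ size (monomials d)].
Proof.
move=> Fd pF us H1 sP szs; have [F0 _ _] := pF; rewrite toC_eq0 in F0.
have [e|f||x l /sP[_ _]//|G [G0 Gd _ Gs Gle]] :=
  @interpolating_form (monomials d) s H d (uniq_monomials d).
- by rewrite mem_monomials => /eqP.
- pose v := \col_(j < size (monomials d)) F@_(nth 0%MM (monomials d) j).
  apply: (@det_eq0_kernel _ _ v).
    apply/colP => a; rewrite !mxE; have /sP[_ Fx _] : nth 0 s (f a) \in s by rewrite mem_nth.
    apply: etrans Fx; rewrite -[in RHS](dhomog_coeffs Fd) meval_form_of_coeffs; apply: eq_bigr => j _.
    by rewrite !mxE.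
  have : msupp F != [::] by rewrite msupp_eq0.
  case E : (msupp F) => [//|m r] _; have mF : m \in msupp F by rewrite E mem_head.
  have md : m \in monomials d by rewrite mem_monomials; apply/eqP/(dhomog_mf Fd).
  have mi : (index m (monomials d) < size (monomials d))%N by rewrite index_mem.
  apply: contraTneq mF => /colP/(_ (Ordinal mi)); rewrite !mxE /= nth_index // => F0m.
  by rewrite mcoeff_msupp F0m eqxx.
- by [].
exists G; split=> //.
have [FG|nFG] := pselect (divides (toC F) (toC G)); last first.
  have := bezout_primitive Fd Gd pF nFG us; rewrite leqNgt szs => /(_ _ _ _)/negP[] // x /sP[] //.
have Gd0 : toC G \is (d + 0).-homog by rewrite addn0; apply: dhomog_map_mpoly.
have [C C0 GE] := divides_dhomog (dhomog_map_mpoly intr Fd) Gd0 FG.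
have Cn0 : C != 0.
  by apply: contraNneq G0 => Cz; rewrite -toC_eq0 GE Cz mulr0.
rewrite GE; apply: prime_elt_mul_unit => //.
have CE : C = (C@_0)%:MP by apply: msize1_polyC; rewrite (msize_dhomog C0 Cn0).
rewrite CE; apply: rmorph_unit; rewrite unitfE.
by apply: contraNneq Cn0 => c0; rewrite CE c0.
Qed.

Lemma exists_mderiv_neq0 d (G : {mpoly int[3]}) : G \is d.-homog -> (0 < d)%N -> G != 0 ->
  exists j, G^`M(j) != 0.
Proof.
move=> Gd d0 G0; have mG := mlead_supp G0.
have md := dhomog_mf Gd mG.
have [j mj] : exists j, mlead G j != 0%N.
  apply: contrapT => /forallNP no; move: d0; rewrite -md /= mdegE big1 // => j _.
  by apply/eqP/negPn/negP/no.
exists j; apply: contraTneq mG => dG; rewrite mcoeff_msupp negbK.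
have le : (U_(j) <= mlead G)%MM by rewrite lep1mP.
have := mcoeff_mderiv j G (mlead G - U_(j))%MM; rewrite dG mcoeff0 submK // => /esym/eqP.
by rewrite mulrn_eq0.
Qed.

Lemma mderiv_toC n (G : {mpoly int[n]}) j : toC G^`M(j) = (toC G)^`M(j).
Proof.
by apply/mpolyP => m; rewrite mcoeff_map_mpoly !mcoeff_mderiv mcoeff_map_mpoly raddfMn.
Qed.

(** The derivative has too small a degree to be a multiple of [G]. If [G] divided x_k, the quotient
    would be constant, and differentiating with respect to x_j, where j differs from k, would make
    dG/dx_j zero. *)
Lemma not_divides_mderiv d (G : {mpoly int[3]}) j k : G \is d.-homog -> (0 < d)%N ->
  prime_elt (toC G) -> k != j -> G^`M(j) != 0 ->
  ~ divides (toC G) (toC ('X_k * G^`M(j))).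
Proof.
move=> Gd d0 pG kj dG0; rewrite rmorphM /= map_mpolyX.
have [G0 _ Gp] := pG; have szG := msize_dhomog (dhomog_map_mpoly intr Gd) G0.
have dG0C : toC G^`M(j) != 0 by rewrite toC_eq0.
case/Gp => -[C E].
  have C0 : C != 0.
    by apply/eqP => Cz; have := msizeX algC (U_(k))%MM; rewrite E Cz mulr0 msize0.
  have := congr1 (fun p : {mpoly algC[3]} => msize p) E.
  rewrite /= msizeX mdeg1 msizeM // szG => szE.
  have szC : (msize C <= 1)%N by move: szE d0; lia.
  have CE := msize1_polyC szC.
  have := congr1 (mderiv j) E.
  rewrite mderivX mnm1E (negbTE kj) scale0r CE mulrC mderiv_mulC => /esym/eqP.
  rewrite mulf_eq0 -CE (negbTE C0) -mderiv_toC (negbTE dG0C) //.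
have C0 : C != 0 by apply: contraNneq dG0C => Cz; rewrite E Cz mulr0.
have := congr1 (fun p : {mpoly algC[3]} => msize p) E.
have dd := dhomog_map_mpoly (intr : int -> algC) (dhomog_mderiv j Gd).
have := msize_poly_eq0 C; rewrite (negbTE C0).
rewrite /= (msize_dhomog dd dG0C) msizeM // szG; lia.
Qed.

Lemma meval_le e (q : {mpoly int[3]}) (B H : int) (x : 'I_3 -> int) :
  q \is e.-homog -> 0 <= B -> 0 <= H -> (forall m, `|q@_m| <= B) -> (forall l, `|x l| <= H) ->
  `|q.@[x]| <= (size (monomials e))%:Z * (B * H ^+ e).
Proof.
move=> qe B0 H0 qB xH; rewrite -(dhomog_coeffs qe) meval_form_of_coeffs.
apply: le_trans (ler_norm_sum _ _ _) _.
apply: le_trans (_ : \sum_(j < size (monomials e)) B * H ^+ e <= _); last first.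
  by rewrite sumr_const card_ord -mulr_natl natz.
apply: ler_sum => j _; rewrite normrM mulrC; apply: ler_pM => //.
have := mem_nth 0%MM (ltn_ord j); move: (nth _ _ j) => m.
rewrite mem_monomials => /eqP <-; rewrite normr_prod mdegE -prodrXr.
by apply: ler_prod => l _; rewrite normrX exprn_ge0 //= lerXn2r ?nnegrE.
Qed.

Lemma mderiv_coeff_le d (G : {mpoly int[3]}) (B : int) j : G \is d.-homog -> 0 <= B ->
  (forall m, `|G@_m| <= B) -> forall m, `|(G^`M(j))@_m| <= B * d%:Z.
Proof.
move=> Gd B0 GB m; rewrite mcoeff_mderiv.
have [->|Gm] := eqVneq (G@_(m + U_(j))) 0; first by rewrite mul0rn normr0 mulr_ge0.
rewrite normrMn -mulr_natr; apply: ler_pM => //.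
rewrite natz lez_nat; have <- := dhomog_mf Gd (_ : (m + U_(j))%MM \in msupp G).
  by rewrite /= mdegD mdeg1 addn1 ltnS mdegE (bigD1 j) //= leq_addr.
by rewrite mcoeff_msupp.
Qed.

(** * Counting points *)

Lemma exp2_size_primes n : (0 < n)%N -> (2 ^ size (primes n) <= n)%N.
Proof.
move=> n0; rewrite {2}(prod_prime_decomp n0) prime_decompE big_map.
have -> s : (2 ^ size s = \prod_(p <- s) 2)%N by rewrite big_const_seq count_predT iter_muln_1.
rewrite big_seq [leqRHS]big_seq; apply: leq_prod => p pn.
have lp : (0 < logn p n)%N by rewrite logn_gt0.
move: pn; rewrite mem_primes => /and3P[pr_p _ _].
by apply: leq_trans (prime_gt1 pr_p) _; rewrite -{1}[p]expn1 leq_exp2l ?prime_gt1.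
Qed.

Lemma exists_prime_not_dvd (ps : seq nat) (n : int) : uniq ps -> {in ps, forall p, prime p} ->
  n != 0 -> (`|n| < 2 ^ size ps)%N -> exists2 p, p \in ps & ~~ (p %| n)%Z.
Proof.
move=> ups pps n0 lt; apply: contrapT => no.
have nn0 : (0 < `|n|)%N by rewrite absz_gt0.
suff : (2 ^ size ps <= `|n|)%N by rewrite leqNgt lt.
apply: leq_trans (exp2_size_primes nn0); rewrite leq_exp2l //.
apply: uniq_leq_size => // p pps'; rewrite mem_primes pps // nn0 /=.
by apply/negPn/negP => pn; apply: no; exists p.
Qed.

Section Counting.
Variables (R : realType) (a b : R) (F G : {mpoly int[3]}) (d D : nat) (m0 : 'X_{1..3}).
Variables (E : seq 'X_{1..3}) (i j k : 'I_3) (P : 'I_3 -> R) (H : int).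
Hypotheses (Fd : F \is d.-homog) (pF : prime_elt (toC F)) (Gd : G \is d.-homog).
Hypotheses (m0F : m0 \in msupp F) (m0max : {in msupp F, forall m, weight_le a b m m0}).
Hypotheses (uE : uniq E) (EP : forall e, e \in E -> mdeg e = D /\ ~~ (m0 <= e)%MM).
Hypotheses (ij : i != j) (ki : k != i) (kj : k != j) (H1 : 1 <= H) (P0 : forall l, 0 <= P l).

Definition box_point (x : 'rV[int]_3) := [/\ primitive x, F.@[x 0] = 0, G.@[x 0] = 0,
  forall l, `|x 0 l| <= H & forall l, `|x 0 l|%:~R <= P l].

(** The left side bounds any determinant of the monomials of [E] at points of the box; for points in
    one nonsingular class [class_det_dvd] makes it divisible by the right side, so that it is 0. *)
Definition prime_large (p : nat) := prime p /\
  (size E)`!%:R * \prod_(e <- E) \prod_l P l ^+ e l < p%:R ^+ 'C(size E, 2).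

(** The two forms have separate roles: [G] gives the p-adic parametrisation, while [F], which has
    [m0] as top monomial, is the one shown not to divide the interpolating form. *)
Lemma local_count (p : nat) (t : seq 'rV[int]_3) : prime_large p -> uniq t ->
  (forall x, x \in t -> [/\ box_point x, ~~ (p %| x 0%R k)%Z & ~~ (p %| G^`M(j).@[x 0%R])%Z]) ->
  (forall x y, x \in t -> y \in t ->
     residue_class p i j k (x 0) = residue_class p i j k (y 0)) ->
  (size t <= 2 * (d * D))%N.
Proof.
move=> [pr_p plarge] ut tP tres.
have tbox x : x \in t -> box_point x by case/tP.
have [e /EP[]//|f||x l /tbox[]//|g [g0 gd gE gt _]] := @interpolating_form E t H D uE.
- apply: contrapT => /eqP det0.
  pose x (c : 'I_(size E)) (l : 'I_3) : int := nth 0 t (f c) 0 l.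
  have xt c : nth 0 t (f c) \in t by rewrite mem_nth.
  have : (p%:Z ^+ 'C(size E, 2) %| \det (eval_matrix x E))%Z.
    apply: (@class_det_dvd G d D i j k p (size E) x (fun e => nth 0%MM E e)) => //.
    + by move=> c; have [[]] := tP _ (xt c).
    + by move=> c; have [] := tP _ (xt c).
    + by move=> c; have [] := tP _ (xt c).
    + move=> c c'; have [_ xk _] := tP _ (xt c); have [_ xk' _] := tP _ (xt c').
      by have [] := residue_class_eq pr_p xk xk' (tres _ _ (xt c) (xt c')).
    + move=> c c'; have [_ xk _] := tP _ (xt c); have [_ xk' _] := tP _ (xt c').
      by have [] := residue_class_eq pr_p xk xk' (tres _ _ (xt c) (xt c')).
    + by move=> e; have [] := EP (mem_nth 0%MM (ltn_ord e)).
  rewrite dvdzE => /dvdn_leq; rewrite absz_gt0 => /(_ det0).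
  rewrite abszX /= -(ler_nat R) leNgt natrX => /negP; apply.
  apply: le_lt_trans plarge.
  rewrite -[_%:R]/((`|\det (eval_matrix x E)|%N%:Z)%:~R) abszE intr_norm.
  rewrite -det_map_mx (big_nth 0%MM) big_mkord.
  apply: det_norm_le => c e; rewrite !mxE rmorph_prod normr_prod.
  apply: ler_prod => l _; rewrite normr_ge0 /= rmorphXn normrX lerXn2r ?nnegrE //.
  have [[_ _ _ _ xP] _ _] := tP _ (xt c); rewrite /= -intr_norm; exact: xP.
- by [].
apply: (bezout_primitive Fd gd pF) => //.
- move=> Fg; have gC0 : toC g != 0 by rewrite toC_eq0.
  have [|m mF|e eg] := divides_top_monomial (a := a) (b := b) (m0 := m0) _ _ gC0 Fg.
  + by rewrite mem_msupp_toC.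
  + by apply: m0max; rewrite -mem_msupp_toC.
  + by rewrite mem_msupp_toC in eg; have [_ /negP] := EP (gE _ eg).
- by move=> x /tbox[].
- by move=> x /tbox[].
Qed.

Hypotheses (pG : prime_elt (toC G)) (dG0 : G^`M(j) != 0) (d0 : (0 < d)%N).

Lemma covering_count (ps : seq nat) (s : seq 'rV[int]_3) (X : nat) : uniq s -> uniq ps ->
  {in ps, forall p, prime_large p /\ (p <= X)%N} ->
  (forall x, x \in s -> box_point x) ->
  (forall x, x \in s -> (absz (x 0 k * G^`M(j).@[x 0])%R < 2 ^ size ps)%N) ->
  (size s <= 2 * (d * d) + size ps * (2 * (d * D) * (d * X)))%N.
Proof.
move=> us ups psP sbox slt.
pose n (x : 'rV[int]_3) : int := x 0 k * G^`M(j).@[x 0].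
pose sp p := [seq x <- s | ~~ (p %| n x)%Z].
have size0 : (size [seq x <- s | n x == 0] <= 2 * (d * d))%N.
  have deg : 'X_k * G^`M(j) \is d.-homog.
    have -> : d = (1 + d.-1)%N by rewrite add1n prednK.
    apply: dhomogM; last exact: dhomog_mderiv.
    by rewrite dhomogX /= mdeg1.
  apply: (bezout_primitive Gd deg pG (not_divides_mderiv Gd d0 pG kj dG0)).
  - by rewrite filter_uniq.
  - by move=> x; rewrite mem_filter => /andP[_ /sbox[]].
  - by move=> x; rewrite mem_filter => /andP[_ /sbox[]].
  - by move=> x; rewrite mem_filter => /andP[/eqP nx _]; rewrite mevalM mevalXU.
have sizep p : p \in ps -> (size (sp p) <= 2 * (d * D) * (d * X))%N.
  move=> pps; have [plarge pX] := psP p pps; have pr_p := plarge.1.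
  have spP x : x \in sp p -> [/\ x \in s, ~~ (p %| x 0%R k)%Z & ~~ (p %| G^`M(j).@[x 0%R])%Z].
    rewrite mem_filter => /andP[nx xs]; split=> //; apply: contra nx => dv.
      exact: dvdz_mulr.
    exact: dvdz_mull.
  apply: leq_trans (size_le_fibers (f := fun x : 'rV_3 => residue_class p i j k (x 0))
    (B := (2 * (d * D))%N) _) _.
    move=> u _; rewrite -size_filter; apply: (local_count plarge).
    - by rewrite !filter_uniq.
    - by move=> x; rewrite mem_filter => /andP[_ /spP[/sbox]].
    - by move=> x y; rewrite !mem_filter => /andP[/eqP -> _] /andP[/eqP ->].
  rewrite leq_mul2l; apply/orP; right.
  apply: leq_trans (card_residue_classes pr_p Gd ij ki kj _) _.
    by move=> x /spP[/sbox[]].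
  by rewrite leq_mul2l pX orbT.
have sum_bool (q : pred 'rV[int]_3) : (\sum_(x <- s) (q x : nat) = size [seq x <- s | q x])%N.
  rewrite size_filter -sum1_count [RHS]big_mkcond; apply: eq_bigr => x _; by case: (q x).
have cover x : x \in s -> (1 <= (n x == 0) + \sum_(p <- ps) ~~ (p %| n x)%Z)%N.
  move=> xs; have [//|nx0] := eqVneq (n x) 0.
  have pps : {in ps, forall p, prime p} by move=> p /psP[[]].
  have [p pin pn] := exists_prime_not_dvd ups pps nx0 (slt x xs).
  by rewrite (big_rem p) //= pn.
apply: leq_trans (_ : (\sum_(x <- s) ((n x == 0) + \sum_(p <- ps) ~~ (p %| n x)%Z) <= _)%N).
  by rewrite -sum1_size big_seq [leqRHS]big_seq; apply: leq_sum.
rewrite big_split /=; apply: leq_add.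
  by rewrite sum_bool.
rewrite exchange_big /=.
apply: leq_trans (_ : (\sum_(p <- ps) 2 * (d * D) * (d * X) <= _)%N); last first.
  by rewrite big_const_seq count_predT iter_addn_0 mulnC.
rewrite big_seq [leqRHS]big_seq; apply: leq_sum => p /sizep; apply: leq_trans.
by rewrite sum_bool.
Qed.
End Counting.

(** * Growth estimates *)

(** With [value_exp], bounds x_k dG/dx_j: the factorial comes from the coefficients of [G], the
    second size from the number of terms of the derivative, [d] from differentiation; the successor
    keeps the constant positive. *)
Definition value_cst (d : nat) : nat :=
  ((size (monomials d))`! * size (monomials d.-1) * d).+1.
Definition value_exp (d : nat) : nat := (d * size (monomials d) + d)%N.

Lemma derivative_value_le (d h : nat) (G : {mpoly int[3]}) (j k : 'I_3) (x : 'I_3 -> int) :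
  (0 < d)%N -> G \is d.-homog ->
  (forall m, `|G@_m| <= (size (monomials d))`!%:Z * (h%:Z ^+ d) ^+ size (monomials d)) ->
  (forall l, `|x l| <= h%:Z) ->
  (absz (x k * G^`M(j).@[x])%R <= value_cst d * h ^ value_exp d)%N.
Proof.
move=> d0 Gd GB xh.
have B0 : 0 <= (size (monomials d))`!%:Z * (h%:Z ^+ d) ^+ size (monomials d).
  by rewrite mulr_ge0 // !exprn_ge0.
have dB := mderiv_coeff_le j Gd B0 GB.
have ev := meval_le (dhomog_mderiv j Gd) (mulr_ge0 B0 (isT : 0 <= d%:Z)) (isT : 0 <= h%:Z) dB xh.
have : `|x k * G^`M(j).@[x]| <= h%:Z * ((size (monomials d.-1))%:Z *
    ((size (monomials d))`!%:Z * (h%:Z ^+ d) ^+ size (monomials d) * d%:Z * h%:Z ^+ d.-1)).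
  by rewrite normrM ler_pM.
set M := size (monomials d) in B0 *; set M' := size _.
rewrite -exprM.
have -> : h%:Z * (M'%:Z * (M`!%:Z * h%:Z ^+ (d * M) * d%:Z * h%:Z ^+ d.-1)) =
    (M`! * M' * d)%N%:Z * h%:Z ^+ (d * M + d).
  rewrite exprD -[in h%:Z ^+ d](prednK d0) exprS !PoszM; ring.
rewrite -abszE => le; rewrite -lez_nat; apply: le_trans le _.
have -> : (value_cst d * h ^ value_exp d)%N%:Z = (value_cst d)%:Z * h%:Z ^+ value_exp d.
  by rewrite PoszM -[Posz (h ^ _)%N]natz natrX natz.
by apply: ler_wpM2r; [exact: exprn_ge0|rewrite lez_nat].
Qed.

Section MainCount.
Variables (R : realType) (a b : R) (F : {mpoly int[3]}) (d D : nat) (m0 : 'X_{1..3}).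
Variables (E : seq 'X_{1..3}) (P : 'I_3 -> R) (h : nat).
Hypotheses (Fd : F \is d.-homog) (pF : prime_elt (toC F)) (d0 : (0 < d)%N).
Hypotheses (m0F : m0 \in msupp F) (m0max : {in msupp F, forall m, weight_le a b m m0}).
Hypotheses (uE : uniq E) (EP : forall e, e \in E -> mdeg e = D /\ ~~ (m0 <= e)%MM).
Hypotheses (h1 : (1 <= h)%N) (P0 : forall l, 0 <= P l).

Lemma main_count (s : seq 'rV[int]_3) (ps : seq nat) (X : nat) : uniq s ->
  (forall x, x \in s -> [/\ primitive x, F.@[x 0] = 0,
     forall l, `|x 0 l| <= h%:Z & forall l, `|x 0 l|%:~R <= P l]) ->
  uniq ps -> {in ps, forall p, prime_large E P p /\ (p <= X)%N} ->
  (value_cst d * h ^ value_exp d < 2 ^ size ps)%N ->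
  (size s <= 2 * (d * d) + size ps * (2 * (d * D) * (d * X)))%N.
Proof.
move=> us sP ups psP lt.
have [le|gt] := leqP (size s) (2 * (d * d)); first exact: leq_trans le (leq_addr _ _).
have h1' : 1 <= h%:Z by rewrite lez_nat.
have [|G [Gd pG Gs GB]] := small_proportional_form Fd pF us h1' _ gt.
  by move=> x /sP[].
have [G0 _ _] := pG; rewrite toC_eq0 in G0.
have [j dG0] := exists_mderiv_neq0 Gd d0 G0.
have [i [k [ij ki kj]]] : exists i k : 'I_3, [/\ i != j, k != i & k != j].
  by case: j {dG0} => [[|[|[|]]]//= ?]; [exists 1, 2|exists 0, 2|exists 0, 1].
apply: (covering_count Fd pF Gd m0F m0max uE EP ij ki kj h1' P0 pG dG0 d0 us ups psP).
  by move=> x xs; have [? ? ? ?] := sP x xs; split=> //; apply: Gs.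
move=> x xs; have [_ _ xh _] := sP x xs.
exact: leq_ltn_trans (derivative_value_le j k d0 Gd GB xh) lt.
Qed.
End MainCount.

Section Asymptotics.
Variable R : realType.
Implicit Types (a b t y z : R).

(** The lower bound lets the number of primes be absorbed in the size of Q; the upper one makes the
    logarithm of Q uniform in a, b and t. For a > 0 the latter holds since (t - a) (t - b) exceeds
    the numerator by (t - a - b + a b) (t - a - b). *)
Lemma exponent_bounds d a b t : (0 < d)%N -> 0 <= a -> a <= b -> b <= 1 ->
  a + b <= t -> 0 < t -> 0 <= exponent d a b t <= 1.
Proof.
move=> d0 a0 ab b1 abt t0; have d1 : 1 <= d%:R :> R by rewrite ler1n.
rewrite /exponent; have [az|an0] := eqVneq a 0.
  have dt0 : 0 < d%:R * t by rewrite mulr_gt0 // (lt_le_trans ltr01).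
  apply/andP; split; first by apply: divr_ge0; [exact: le_trans ab|exact: ltW].
  rewrite ler_pdivrMr // mul1r.
  by apply: le_trans (_ : 1 * t <= _); [lra|rewrite ler_wpM2r // ltW].
have a_gt0 : 0 < a by rewrite lt_neqAle eq_sym an0.
have ta : 0 < t - a by lra.
have tb : 0 < t - b by lra.
have num0 : 0 <= a * b + (a + b - a * b) * (t - a - b).
  have : a * b <= a * 1 by rewrite ler_wpM2l.
  move=> ?; rewrite addr_ge0 ?mulr_ge0 //; lra.
have den0 : 0 < d%:R * (t - a) * (t - b) by rewrite !mulr_gt0 // (lt_le_trans ltr01).
apply/andP; split; first by apply: divr_ge0 => //; exact: ltW.
rewrite ler_pdivrMr // mul1r.
apply: le_trans (_ : 1 * ((t - a) * (t - b)) <= _); last first.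
  by rewrite -mulrA ler_wpM2r // mulr_ge0 // ltW.
rewrite mul1r -subr_ge0.
have -> : (t - a) * (t - b) - (a * b + (a + b - a * b) * (t - a - b)) =
   (t - a - b + a * b) * (t - a - b) by ring.
have : 0 <= a * b by rewrite mulr_ge0 // (le_trans a0).
by move=> ?; rewrite mulr_ge0 //; lra.
Qed.

Lemma le_expR_div (e y : R) : 0 < e -> y <= expR (e * y) / e.
Proof.
move=> e0; rewrite ler_pdivlMr // mulrC.
by apply: le_trans (expR_ge1Dx _); rewrite lerDr.
Qed.

Lemma trunc_log2_le (n : nat) (z : R) : (0 < n)%N -> n%:R <= expR z ->
  (trunc_log 2 n)%:R <= z / ln 2.
Proof.
move=> n0 nz; have ln2 : 0 < ln 2 :> R by rewrite ln_gt0 // ltr1n.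
rewrite ler_pdivlMr // mulr_natl -lnXn // -[leRHS]expRK ler_ln ?posrE ?exprn_gt0 ?expR_gt0 //.
by apply: le_trans nz; rewrite -natrX ler_nat trunc_logP.
Qed.

(** The logarithm of C exp(A y) is ln C + A y, and y <= exp(e y) / e; dividing by [ln 2] changes the
    base, and the leading 1 covers a successor. *)
Definition log_cst (e A C : R) : R := 1 + (ln C + A / e) / ln 2.

Lemma log_cst_ge1 (e A C : R) : 0 < e -> 0 <= A -> 1 <= C -> 1 <= log_cst e A C.
Proof.
move=> e0 A0 C1; rewrite /log_cst lerDl divr_ge0 ?ln_ge0 // ?ler1n //.
by rewrite addr_ge0 ?ln_ge0 // divr_ge0 // ltW.
Qed.

Lemma trunc_log2_growth (e A C y : R) (n : nat) : 0 < e -> 0 <= A -> 1 <= C -> 0 <= y ->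
  (0 < n)%N -> n%:R <= C * expR (A * y) ->
  (trunc_log 2 n).+1%:R <= log_cst e A C * expR (e * y).
Proof.
move=> e0 A0 C1 y0 n0 nle.
have C0 : 0 < C by apply: lt_le_trans C1.
have ln2 : 0 < ln 2 :> R by rewrite ln_gt0 // ltr1n.
have ex1 : 1 <= expR (e * y) by rewrite -expR0 ler_expR mulr_ge0 // ltW.
have := @trunc_log2_le n (ln C + A * y) n0.
rewrite expRD lnK // => /(_ nle) tle.
rewrite -natr1 addrC /log_cst mulrDl mul1r; apply: lerD => //.
apply: le_trans tle _; rewrite mulrAC ler_wpM2r ?invr_ge0 ?(ltW ln2) //.
rewrite mulrDl; apply: lerD; first by rewrite ler_peMr // ln_ge0.
by rewrite -mulrA ler_wpM2l // mulrC le_expR_div.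
Qed.
End Asymptotics.

Lemma box_monomial (R : realType) (P : 'I_3 -> R) (m : 'X_{1..3}) :
  (forall l, 0 < P l) -> 0 < ln (P 2) ->
  \prod_l P l ^+ m l = expR (weight (ln (P 0) / ln (P 2)) (ln (P 1) / ln (P 2)) m * ln (P 2)).
Proof.
move=> P0 y0; rewrite ord3_big mulr1 /weight.
have pw l : P l ^+ m l = expR ((m l)%:R * ln (P l)) by rewrite expRM_natl lnK // posrE.
rewrite !pw -!expRD; congr expR.
have yn0 := lt0r_neq0 y0; field; exact: yn0.
Qed.

Lemma bigmax_attained (R : realDomainType) (T : eqType) (s : seq T) (f : T -> R) (x : T) :
  x \in s -> {in s, forall z, f z <= f x} -> 0 <= f x ->
  \big[Num.max/0]_(z <- s) f z = f x.
Proof.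
move=> xs fle fx0; apply: le_anti; apply/andP; split.
  by rewrite big_seq; elim/big_rec: _ => // z M zs ?; rewrite ge_max fle.
elim: s xs {fle} => // z s IH; rewrite in_cons big_cons le_max => /orP[/eqP->|/IH ->].
  by rewrite lexx.
by rewrite orbT.
Qed.

(** The factorial of [size E] is at most S! and so at most the power of S! with exponent
    ['C(size E, 2)]; a bound on p that depends on [S] only thus suffices. *)
Lemma prime_large_of_gt (R : realType) (E : seq 'X_{1..3}) (P : 'I_3 -> R) (p S : nat) (w : R) :
  (forall l, 0 <= P l) -> prime p -> (1 < size E)%N -> (size E <= S)%N ->
  \prod_(e <- E) \prod_l P l ^+ e l <= expR w ^+ 'C(size E, 2) ->
  S`!%:R * expR w < p%:R -> prime_large E P p.
Proof.
move=> P0 pr_p E1 ES Ple plt; split=> //.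
have N0 : (0 < 'C(size E, 2))%N by rewrite bin_gt0.
have S1 : 1 <= S`!%:R :> R by rewrite ler1n fact_gt0.
apply: le_lt_trans (_ : (S`!%:R * expR w) ^+ 'C(size E, 2) < _); last first.
  by rewrite ltrXn2r ?nnegrE ?mulr_ge0 ?expR_ge0 // -lt0n.
rewrite exprMn; apply: ler_pM => //.
  by apply: prodr_ge0 => e _; apply: prodr_ge0 => l _; apply: exprn_ge0.
apply: le_trans (_ : S`!%:R <= _); first by rewrite ler_nat leq_fact.
by rewrite -[leLHS]expr1 ler_weXn2l.
Qed.

Theorem theorem1 (R : realType) (d : nat) (hd : (1 <= d)%N)
    (eps : R) (heps : 0 < eps) :
  exists C : R, 0 < C /\
    forall (F : {mpoly int[3]}) (P : 'I_3 -> R),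
      F \is d.-homog ->
      absolutely_irreducible F ->
      1 <= P 0 -> P 0 <= P 1 -> P 1 <= P 2 -> 1 < P 2 ->
      let T := max_monomial F P in
      let alpha := ln (P 0) / ln (P 2) in
      let beta := ln (P 1) / ln (P 2) in
      let tau := ln T / (d%:R * ln (P 2)) in
      1 < T ->
      (P 0 * P 1) ^+ d <= T ->
      (num_zeros F P)%:R <=
        C * P 2 `^ eps * expR (exponent d alpha beta tau * ln (P 2)).
Proof.
(* One third each for the interpolation monomials, the number [r] of primes and the exponent [k] in
   their size. *)
pose e1 := eps / 3; have e10 : 0 < e1 by rewrite divr_gt0.
have [D Dset] := monomial_set hd e10.
pose S0 : nat := size (monomials D).
pose K : R := log_cst e1 (value_exp d)%:R (value_cst d)%:R.
(* Up to powers of [P 2], [K] bounds the number of primes, [K3] the sum q + r and [K4] the exponent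
   k; in the final constant, 2 [K3] bounds 2^k and 16 comes from [primes_in_interval]. *)
pose K3 : R := S0`!%:R + K.
pose K4 : R := log_cst e1 (1 + e1) K3.
have K1 : 1 <= K by apply: log_cst_ge1 => //; rewrite ler1n.
have S1 : 1 <= S0`!%:R :> R by rewrite ler1n fact_gt0.
have K31 : 1 <= K3 by rewrite /K3; lra.
have K41 : 1 <= K4 by apply: log_cst_ge1 => //; lra.
exists ((2 * (d * d))%:R + K * ((2 * (d * D) * d * 16)%:R * (2 * K3 * K4))); split.
  rewrite ltr_wpDr //; last by rewrite ltr0n !muln_gt0 hd.
  by rewrite !mulr_ge0 //; lra.
move=> F P Fd Firr P01 P0P1 P1P2 P21 T alpha beta tau T1 Tge.
pose y := ln (P 2); have y0 : 0 < y by rewrite ln_gt0.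
have P1_ge1 := le_trans P01 P0P1.
have Pge1 l : 1 <= P l.
  case: l => [[|[|[|]]]//= lt].
  - by rewrite (_ : Ordinal lt = 0) //; apply: val_inj.
  - by rewrite (_ : Ordinal lt = 1) //; apply: val_inj.
  - by rewrite (_ : Ordinal lt = 2) ?(ltW P21) //; apply: val_inj.
have PleP2 l : P l <= P 2.
  case: l => [[|[|[|]]]//= lt].
  - by rewrite (_ : Ordinal lt = 0) ?(le_trans P0P1) //; apply: val_inj.
  - by rewrite (_ : Ordinal lt = 1) //; apply: val_inj.
  - by rewrite (_ : Ordinal lt = 2) //; apply: val_inj.
have Pgt0 l : 0 < P l by apply: lt_le_trans (Pge1 l).
have a0 : 0 <= alpha by rewrite divr_ge0 ?ln_ge0 // ltW.
have ab : alpha <= beta by rewrite ler_wpM2r ?invr_ge0 ?(ltW y0) // ler_ln ?posrE.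
have b1 : beta <= 1 by rewrite ler_pdivrMr // mul1r ler_ln ?posrE.
have pF := irreducible_mpoly_prime Firr.
have [F0 _ _] := pF; rewrite toC_eq0 in F0.
have suppF : msupp F != [::] by rewrite msupp_eq0.
have [m0 m0F m0max] := seq_maximum (@weight_le_refl R alpha beta)
  (@weight_le_trans R alpha beta) (@weight_le_total R alpha beta) suppF.
have monE := box_monomial _ Pgt0 y0.
have TE : T = expR (weight alpha beta m0 * y).
  rewrite -monE; apply: bigmax_attained => //.
    move=> m /m0max mle; rewrite !monE ler_expR ler_wpM2r ?(ltW y0) //.
    by case/orP: mle => [/ltW|/andP[/eqP-> _]].
  by rewrite monE expR_ge0.
have dR0 : 0 < d%:R :> R by rewrite ltr0n.
have tauE : d%:R * tau = weight alpha beta m0.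
  rewrite /tau TE expRK -/y; field; apply/andP; split; exact: lt0r_neq0.
have tau0 : 0 < tau by apply: divr_gt0; [exact: ln_gt0|exact: mulr_gt0].
(* This is the hypothesis T >= (P_1 P_2)^d after taking logarithms. *)
have abt : alpha + beta <= tau.
  rewrite -(ler_pM2l dR0) tauE -(ler_pM2r y0) -ler_expR -TE.
  rewrite -mulrA expRM_natl mulrDl !divfK ?gt_eqF //.
  by rewrite expRD !lnK ?posrE.
have m0d : mdeg m0 = d by apply: (dhomog_mf Fd).
have [E [uE E1 EP Ew]] := Dset _ _ _ _ m0d a0 ab b1 abt tau0 tauE.
have /andP[th0 th1] := exponent_bounds hd a0 ab b1 abt tau0.
set th := exponent d alpha beta tau in Ew th0 th1 *.
pose h := Num.truncn (P 2).
have P2_0 : 0 <= P 2 by exact: ltW.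
have h1 : (1 <= h)%N by rewrite truncn_ge_nat // ltW.
have hP : h%:R <= P 2 by rewrite truncn_le.
(* Primes above [Q] are large enough: [Ew] bounds the product of the monomials by the power
   ['C(size E, 2)] of the exponential, and [size E] is at most [S0]. *)
pose Q : R := S0`!%:R * expR ((th + e1) * y).
pose q := Num.truncn Q.
have Q0 : 0 <= Q by rewrite mulr_ge0 // expR_ge0.
pose n := (value_cst d * h ^ value_exp d)%N.
have n0 : (0 < n)%N by rewrite muln_gt0 /= expn_gt0 h1.
(* Since 2^r > n, a non-zero integer of absolute value at most n is not divisible by r distinct
   primes. *)
pose r := (trunc_log 2 n).+1.
have rle : r%:R <= K * expR (e1 * y).
  apply: trunc_log2_growth => //; rewrite ?ler1n //; first exact: ltW.
  rewrite natrM natrX ler_wpM2l // expRM_natl lnK ?posrE //.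
  by rewrite lerXn2r ?nnegrE.
(* Then q + r < 2^k <= 2 (q + r): the first inequality is needed to find the primes, the second
   bounds their size. *)
pose k := (trunc_log 2 (q + r)).+1.
have qr_le : (q + r)%:R <= K3 * expR ((th + e1) * y).
  rewrite natrD /K3 mulrDl; apply: lerD; first by rewrite truncn_le.
  apply: le_trans rle _; rewrite ler_wpM2l ?(le_trans ler01) // ler_expR ler_wpM2r ?(ltW y0) //.
  by rewrite lerDr.
have kle : k%:R <= K4 * expR (e1 * y).
  apply: trunc_log2_growth => //; [lra|exact: ltW|by rewrite addnS|].
  apply: le_trans qr_le _; rewrite ler_wpM2l ?(le_trans ler01) // ler_expR ler_wpM2r ?(ltW y0) //.
  by rewrite lerD2r.
have [//||ps [ups szps psP]] := @primes_in_interval q r k _.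
  by apply: ltnW; apply: trunc_log_ltn.
pose X := (16 * (2 ^ k * k))%N.
have psP' : {in ps, forall p, prime_large E P p /\ (p <= X)%N}.
  move=> p /psP /and3P[pr_p qp pX]; split=> //.
  apply: (@prime_large_of_gt _ _ _ _ S0 ((th + e1) * y)) => //.
  - by move=> l; apply: ltW.
  - by apply: uniq_leq_size => // e /EP[eD _]; rewrite mem_monomials eD.
  - under eq_bigr do rewrite monE.
    rewrite -expR_sum -mulr_suml -expRM_natl ler_expR mulrA [_ * (th + e1)]mulrC.
    by rewrite ler_wpM2r // ltW.
  - rewrite -/Q; apply: lt_le_trans (truncnS_gt Q) _; by rewrite ler_nat.
pose s : seq 'rV[int]_3 := fset_set (zeros_in_box F P).
have sP x : x \in s -> [/\ primitive x, F.@[x 0] = 0,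
     forall l, `|x 0 l| <= h%:Z & forall l, `|x 0 l|%:~R <= P l].
  rewrite in_fset_set; last exact: finite_zeros_in_box.
  rewrite inE => -[Fx xP px]; split=> // l.
  rewrite -abszE lez_nat truncn_ge_nat //.
  by apply: le_trans (le_trans (xP l) (PleP2 l)); rewrite -abszE.
have us : uniq s by apply: fset_uniq.
have lt : (value_cst d * h ^ value_exp d < 2 ^ size ps)%N by rewrite szps trunc_log_ltn.
have cnt := main_count Fd pF hd m0F m0max uE EP h1 (fun l => ltW (Pgt0 l)) us sP ups psP' lt.
have -> : (num_zeros F P) = size s by [].
have ey : P 2 `^ eps * expR (th * y) = expR ((th + e1 + e1 + e1) * y).
  rewrite /powR gt_eqF // -expRD -/y; congr expR; rewrite /e1; by field.
rewrite -mulrA ey.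
apply: le_trans (_ : ((2 * (d * d))%N + r * (2 * (d * D) * (d * X)))%:R <= _).
  by rewrite ler_nat -szps.
rewrite natrD mulrDl; apply: lerD.
  by rewrite ler_peMr // -expR0 ler_expR mulr_ge0 ?(ltW y0) // !addr_ge0 // ltW.
have kX : X%:R <= 16 * (2 * K3 * expR ((th + e1) * y)) * (K4 * expR (e1 * y)).
  rewrite /X mulnA natrM; apply: ler_pM => //.
  rewrite natrM ler_wpM2l // -mulrA /k expnS natrM ler_wpM2l //.
  by apply: le_trans qr_le; rewrite ler_nat trunc_logP // addnS.
have -> : ((r * (2 * (d * D) * (d * X)))%N%:R : R) = r%:R * ((2 * (d * D) * d)%N%:R * X%:R).
  by rewrite natrM mulnA natrM.
have -> : K * ((2 * (d * D) * d * 16)%:R * (2 * K3 * K4)) * expR ((th + e1 + e1 + e1) * y) =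
  (K * expR (e1 * y)) * ((2 * (d * D) * d)%N%:R *
   (16 * (2 * K3 * expR ((th + e1) * y)) * (K4 * expR (e1 * y)))).
  have -> : (th + e1 + e1 + e1) * y = (th + e1) * y + e1 * y + e1 * y by ring.
  by move: (2 * (d * D) * d)%N => c; rewrite !expRD natrM; ring.
apply: ler_pM => //; first by rewrite mulr_ge0.
by rewrite ler_wpM2l.
Qed.
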